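(* Let $K$ be an algebraically closed field of characteristic zero, let $a\ge0$, $d,m\ge1$, $I=a+d\{0,1,\dots,m\}$, $s=m+1$, $N=a+dm$, with $2\le s\le r<N$, and let $\pi=(e,(n_\nu)_\nu)$ be a dominant admissible profile, i.e. one with $w_\nu>0$ for every $\nu$ with $n_\nu>0$. With the notation of the context, the affine variety $Y_\pi^{\rm mon}$ is normal if and only if both of the following conditions hold: (A) the sets $\mathcal D_\nu=\{h_\nu,2h_\nu,\dots,n_\nu h_\nu\}$ (over the types $\nu$ with $n_\nu>0$) are pairwise disjoint; (B) $\lambda_{\nu,h_\nu j}\ne0$ for all $\nu$ with $n_\nu>0$ and all $1\le j\le n_\nu$. When they hold, $Y_\pi^{\rm mon}\simeq\mathbb A^m$, and in particular it is smooth.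
   Context: $\mathbb P^j$ is the projective space of lines of binary forms of degree $j$ in $X,Z$ over $K$. $V_I=\bigoplus_{i\in I}K\,X^iZ^{N-i}$. $\overline{\mathfrak Z}_I=\{([G],[H])\in\mathbb P^r\times\mathbb P^{N-r}:GH\in\mathbb P(V_I)\}$, with $p([G],[H])=[G]$. For $t=(t_i)_{i\in I\setminus\{N\}}$, $F_t(x)=x^N+\sum_{i\in I\setminus\{N\}}t_ix^i=x^a\overline F_t(x^d)$, with $\overline F_t$ monic of degree $m$. $U_I^{\rm reg}$ is the set of $t$ with $t_a\neq0$ and $\overline F_t$ having $m$ distinct nonzero roots. Fix a primitive $d$th root of unity $\zeta$. For $t\in U_I^{\rm reg}$, the nonzero roots of $F_t$ form $m$ blocks $\{x:x^d=y\}$, one for each root $y$ of $\overline F_t$, each cyclically ordered by multiplication by $\zeta$. A binary necklace $\nu$ of length $d$ is a $C_d$-orbit of binary words of length $d$, with Hamming weight $w_\nu$ and rotation-stabilizer order $h_\nu$. An admissible profile $\pi=(e,(n_\nu)_\nu)$ consists of an integer $e$ with $\max\{0,r-dm\}\le e\le\min\{a,r\}$ and integers $n_\nu\ge0$ with $\sum_\nu n_\nu=m$, $\sum_\nu n_\nu w_\nu=r-e$. $W_\pi$ is the reduced closure in $\overline{\mathfrak Z}_I$ of the set of factorizations $F_t=gh$ ($t\in U_I^{\rm reg}$; $g,h$ monic of degrees $r,N-r$) such that $0$ is a root of $g$ of multiplicity $e$ and for each $\nu$ exactly $n_\nu$ blocks have the property that the subset of roots of $g$ in the block is, read cyclically,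 the necklace $\nu$. $\overline Y_\pi=p(W_\pi)\subset\mathbb P^r$ with reduced structure. Every form in $\overline Y_\pi$ is divisible by $X^e$; $Y_\pi^{\rm mon}$ is the affine chart of $\overline Y_\pi$ on which the remaining form $G/X^e$, of degree $R=r-e$, is monic (i.e. has nonzero $X^{R}$-coefficient). For each $\nu$ choose a subset $S_\nu\subseteq\mathbb Z/d\mathbb Z$ representing it ($|S_\nu|=w_\nu$). The Fourier coefficients are $\lambda_{\nu,k}=\sum_{b\in S_\nu}\zeta^{bk}$. *)

(* Defs.v *)
From mathcomp Require Import all_boot all_order all_algebra.
From mathcomp Require Import mpoly.

Set Implicit Arguments.
Unset Strict Implicit.
Unset Printing Implicit Defensive.

Import GRing.Theory.
Local Open Scope ring_scope.

Definition word (d : nat) := d.-tuple bool.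

(* The C_d-orbit of w (for d > 0), C_d acting by rotation. *)
Definition rotations (d : nat) (w : word d) : {set d.-tuple bool} :=
  [set [tuple of rot k w] | k : 'I_d].

Definition is_necklace (d : nat) (nu : {set d.-tuple bool}) : bool :=
  [exists w : d.-tuple bool, nu == rotations w].

Definition necklace (d : nat) : Type :=
  {nu : {set d.-tuple bool} | is_necklace nu}.

(* An arbitrary representative; weight and stabilizer order do not depend on
   the choice because rotations preserve the number of letters and C_d is
   abelian. *)
Definition necklace_word (d : nat) (nu : necklace d) : word d :=
  xchoose (existsP (valP nu)).

Definition weight (d : nat) (nu : necklace d) : nat :=
  count id (necklace_word nu).

Definition stab_order (d : nat) (nu : necklace d) : nat :=
  #|[set k : 'I_d | rot k (necklace_word nu) == necklace_word nu]|.

(* 'I_d, with d > 0, stands for Z/dZ. *)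
Definition represents (d : nat) (S : {set 'I_d}) (nu : necklace d) : Prop :=
  [tuple i \in S | i < d] \in val nu.

Definition fourier (K : nzRingType) (d : nat) (zeta : K) (S : {set 'I_d})
    (k : nat) : K :=
  \sum_(b in S) zeta ^+ (b * k).

Record profile (d : nat) := Profile {
  zero_mult : nat;
  block_count : necklace d -> nat
}.

(* The truncated r - d * m is max {0, r - dm}. *)
Definition admissible (a d m r : nat) (pi : profile d) : Prop :=
  [/\ (r - d * m <= zero_mult pi)%N,
      (zero_mult pi <= minn a r)%N,
      (\sum_nu block_count pi nu = m)%N &
      (\sum_nu block_count pi nu * weight nu)%N = (r - zero_mult pi)%N].

Definition dominant (d : nat) (pi : profile d) : Prop :=
  forall nu, (0 < block_count pi nu)%N -> (0 < weight nu)%N.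

Definition degree_set (d : nat) (pi : profile d) (nu : necklace d) : seq nat :=
  [seq (stab_order nu * j)%N | j <- iota 1 (block_count pi nu)].

Definition disjoint_degrees (d : nat) (pi : profile d) : Prop :=
  forall nu nu' : necklace d,
    (0 < block_count pi nu)%N -> (0 < block_count pi nu')%N -> nu <> nu' ->
  forall k, k \in degree_set pi nu -> k \notin degree_set pi nu'.

Definition nonzero_fourier (K : nzRingType) (d : nat) (zeta : K)
    (pi : profile d) (S : necklace d -> {set 'I_d}) : Prop :=
  forall nu : necklace d, (0 < block_count pi nu)%N ->
  forall j, (1 <= j <= block_count pi nu)%N ->
    fourier zeta (S nu) (stab_order nu * j) != 0.

Definition exponent_set (a d m : nat) : seq nat :=
  [seq (a + d * j)%N | j <- iota 0 m.+1].

(* t 0 j is the coefficient t_{a + dj}. *)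
Definition Fpoly (K : nzRingType) (a d m : nat) (t : 'rV[K]_m) : {poly K} :=
  'X^(a + d * m) + \sum_(j < m) t 0 j *: 'X^(a + d * j).

Definition Fbar (K : nzRingType) (m : nat) (t : 'rV[K]_m) : {poly K} :=
  'X^m + \sum_(j < m) t 0 j *: 'X^j.

Lemma Fpoly_Fbar (K : comNzRingType) (a d m : nat) (t : 'rV[K]_m) :
  Fpoly a d t = 'X^a * (Fbar t \Po 'X^d).
Proof.
rewrite /Fpoly /Fbar comp_polyD comp_Xn_poly raddf_sum mulrDr -exprM -exprD.
rewrite mulr_sumr; congr (_ + _); apply: eq_bigr => j _.
by rewrite /= comp_polyZ comp_Xn_poly -exprM -scalerAr -exprD.
Qed.

Definition regular (K : fieldType) (a d m : nat) (t : 'rV[K]_m) : Prop :=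
  (Fpoly a d t)`_a != 0 /\
  exists ys : m.-tuple K,
    [/\ uniq ys, 0 \notin (ys : seq K) & all (root (Fbar t)) ys].

(* The roots of g in the block {x, zeta x, ..., zeta^(d-1) x}, as a word. *)
Definition read_block (K : nzRingType) (d : nat) (zeta : K) (g : {poly K})
    (x : K) : word d :=
  [tuple root g (zeta ^+ i * x) | i < d].

(* Changing the base point x of the block rotates the word. *)
Definition block_has_necklace (K : nzRingType) (d : nat) (zeta : K)
    (g : {poly K}) (y : K) (nu : necklace d) : Prop :=
  exists2 x : K, x ^+ d = y & read_block d zeta g x \in val nu.

Definition profile_factorization (K : fieldType) (a d m r : nat) (zeta : K)
    (pi : profile d) (g h : {poly K}) : Prop :=
  exists t : 'rV[K]_m,
  [/\ regular a d t,
      Fpoly a d t = g * h,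
      g \is monic /\ size g = r.+1,
      h \is monic /\ size h = (a + d * m - r).+1 &
      mup 0 g = zero_mult pi /\
      exists (ys : m.-tuple K) (tau : 'I_m -> necklace d),
        [/\ uniq ys, all (root (Fbar t)) ys,
            forall i, block_has_necklace zeta g (tnth ys i) (tau i) &
            forall nu, #|[set i | tau i == nu]| = block_count pi nu]].

(* A binary form of degree j is its vector of coefficients: entry i of
   'rV_(j.+1) is the coefficient of X^i Z^(j-i), so that rVpoly sets Z = 1.
   A point of the projective space P^j is a nonzero such vector up to scaling,
   and a subset of P^j or P^j x P^k is a scaling-invariant predicate on nonzero
   vectors. *)

Definition Zbar (K : fieldType) (a d m r q : nat)
    (G : 'rV[K]_r.+1) (H : 'rV[K]_q.+1) : Prop :=
  [/\ G != 0, H != 0 &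
      forall k, k \notin exponent_set a d m -> (rVpoly G * rVpoly H)`_k = 0].

Definition bihomogeneous (K : nzRingType) (r q D E : nat)
    (P : {mpoly K[r.+1 + q.+1]}) : Prop :=
  forall mon, mon \in msupp P ->
    (\sum_(i < r.+1) mon (lshift q.+1 i) = D)%N /\
    (\sum_(i < q.+1) mon (rshift r.+1 i) = E)%N.

Definition biproj_closure (K : fieldType) (r q : nat)
    (S : 'rV[K]_r.+1 -> 'rV[K]_q.+1 -> Prop)
    (G : 'rV[K]_r.+1) (H : 'rV[K]_q.+1) : Prop :=
  [/\ G != 0, H != 0 &
      forall D E (P : {mpoly K[r.+1 + q.+1]}), bihomogeneous D E P ->
        (forall G' H', S G' H' -> P.@[row_mx G' H' 0] = 0) ->
        P.@[row_mx G H 0] = 0].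

Definition W (K : fieldType) (a d m r : nat) (zeta : K) (pi : profile d)
    (G : 'rV[K]_r.+1) (H : 'rV[K]_(a + d * m - r).+1) : Prop :=
  Zbar a d m G H /\
  biproj_closure
    (fun G' H' => exists g h, profile_factorization a m r zeta pi g h /\
                              G' = poly_rV g /\ H' = poly_rV h) G H.

Definition Ybar (K : fieldType) (a d m r : nat) (zeta : K) (pi : profile d)
    (G : 'rV[K]_r.+1) : Prop :=
  exists H, @W K a d m r zeta pi G H.

(* The point c of affine R-space, R = r - e, is the form
   X^e (X^R + sum_(i < R) c_i X^i Z^(R-i)) of degree r. *)
Definition monic_form (K : fieldType) (r e : nat) (c : 'rV[K]_(r - e)) :
    'rV[K]_r.+1 :=
  poly_rV ('X^e * ('X^(r - e) + rVpoly c)).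

Definition Ymon (K : fieldType) (a d m r : nat) (zeta : K) (pi : profile d)
    (c : 'rV[K]_(r - zero_mult pi)) : Prop :=
  Ybar a m zeta pi (monic_form c).

Definition vanishes_on (K : fieldType) (n : nat) (Y : 'rV[K]_n -> Prop)
    (p : {mpoly K[n]}) : Prop :=
  forall y, Y y -> p.@[y 0] = 0.

(* (A, phi) is the coordinate ring K[x_1, ..., x_n] / I(Y) together with the
   quotient map. *)
Definition is_coordinate_ring (K : fieldType) (n : nat)
    (Y : 'rV[K]_n -> Prop) (A : nzRingType)
    (phi : {rmorphism {mpoly K[n]} -> A}) : Prop :=
  (forall b : A, exists p, phi p = b) /\
  (forall p, phi p = 0 <-> vanishes_on Y p).

Definition integrally_closed (A : idomainType) : Prop :=
  forall u : {fraction A},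
    integralOver (@tofrac A) u -> exists b : A, u = tofrac b.

Definition normal_variety (K : fieldType) (n : nat)
    (Y : 'rV[K]_n -> Prop) : Prop :=
  exists (A : idomainType) (phi : {rmorphism {mpoly K[n]} -> A}),
    is_coordinate_ring Y phi /\ integrally_closed A.

Definition poly_map (K : fieldType) (n k : nat) (f : 'I_k -> {mpoly K[n]})
    (x : 'rV[K]_n) : 'rV[K]_k :=
  \row_i (f i).@[x 0].

Definition isomorphic_varieties (K : fieldType) (n k : nat)
    (Y : 'rV[K]_n -> Prop) (Y' : 'rV[K]_k -> Prop) : Prop :=
  exists (f : 'I_k -> {mpoly K[n]}) (g : 'I_n -> {mpoly K[k]}),
    [/\ forall y, Y y -> Y' (poly_map f y),
        forall z, Y' z -> Y (poly_map g z),
        forall y, Y y -> poly_map g (poly_map f y) = y &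
        forall z, Y' z -> poly_map f (poly_map g z) = z].

Definition affine_space (K : fieldType) (k : nat) (x : 'rV[K]_k) : Prop := True.

(* Algebraic independence over K of the restrictions of the f_i to Y. *)
Definition alg_independent_on (K : fieldType) (n k : nat)
    (Y : 'rV[K]_n -> Prop) (f : 'I_k -> {mpoly K[n]}) : Prop :=
  forall P : {mpoly K[k]},
    (forall y, Y y -> P.@[poly_map f y 0] = 0) -> P = 0.

(* Transcendence degree over K of the coordinate ring. *)
Definition has_dimension (K : fieldType) (n : nat) (Y : 'rV[K]_n -> Prop)
    (k : nat) : Prop :=
  (exists f : 'I_k -> {mpoly K[n]}, alg_independent_on Y f) /\
  (forall f : 'I_k.+1 -> {mpoly K[n]}, ~ alg_independent_on Y f).

Definition tangent_vector (K : fieldType) (n : nat) (Y : 'rV[K]_n -> Prop)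
    (y v : 'rV[K]_n) : Prop :=
  forall p, vanishes_on Y p -> \sum_(i < n) (p^`M(i)).@[y 0] * v 0 i = 0.

(* For irreducible Y: the Zariski tangent spaces all have dimension dim Y. *)
Definition smooth_variety (K : fieldType) (n : nat)
    (Y : 'rV[K]_n -> Prop) : Prop :=
  exists k, has_dimension Y k /\
    forall y, Y y -> exists T : {vspace 'rV[K]_n},
      \dim T = k /\ forall v, v \in T <-> tangent_vector Y y v.

(* Main.v *)
(* Proof idea.  Up to the factor X^e, the monic chart is the image of the map
   sending x in K^m to the polynomial Pi_x whose roots are the zeta^b x_i with
   b in S_(tau i), where tau lists the necklaces with multiplicities n_nu; being
   the image of a linear space under "coefficients of the polynomial with these
   roots", it is closed.  Let A be its coordinate ring, inside K[x_1, ..., x_m],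
   and let P_(nu,j) be the sum of the x_i^(h_nu j) over tau i = nu.  In
   characteristic 0, A is generated by the power sums
     p_k = sum_nu lambda_(nu,k) P_(nu,k/h_nu),
   where lambda_(nu,k) = 0 unless h_nu divides k.  All P_(nu,j) are integral
   over A and lie in its fraction field, because a generic Pi_x determines x up
   to permutations inside each type and multiplications by h_nu-th roots of
   unity.  If A is normal, each P_(nu,j) is thus a polynomial in the
   coefficients of Pi_x; restricted to a line through 0 and a point where the power
   sums of degree less than k = h_nu j vanish, only its linear part contributes
   in degree k, and comparing two such points gives (A) and (B).
   Conversely (A) and (B) let one solve the above relations for the elementary
   symmetric functions of the x_i^h_nu of each type by induction on the degree;
   these m functions are coordinates on an affine space. *)

Require Import Defs.
From mathcomp Require Import all_boot all_order all_algebra.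
From mathcomp Require Import all_fingroup cyclic separable cyclotomic generic_quotient.
From mathcomp Require Import mpoly zify ring.

Set Implicit Arguments.
Unset Strict Implicit.
Unset Printing Implicit Defensive.

Import Order.TTheory GRing.Theory.
Local Open Scope ring_scope.

(** * Polynomial functions *)

(** The ring [A] is never formed as a subring: that a function [q] of [x] belongs to it is the
    statement [polyfun param_coefs q]. Since [K] is infinite, polynomials are determined by their
    values, so identities are checked at points, and it is enough to check them where a discriminant
    does not vanish. Two facts that usually rest on finite morphisms and Galois theory are obtained
    by symmetrizing over the permutations of the roots, which depend linearly on [x]: the image of
    [x |-> Pi_x] is closed, and a generically well-defined function of [Pi_x] is a quotient of
    polynomials in its coefficients. Dominance makes every [S (tau i)] nonempty, so each [x_i] is a
    root of [Pi_x] up to a power of [zeta]; both integrality and the generic recovery of [x] come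
    from this. In the necessity part the coefficient of index [l] has weight [R - l] under scaling
    of [x]. The constant relating [P_(nu,j)] to [p_k] comes from the linear part of one fixed
    polynomial, so it is the same at points supported on different types; a coincidence of degrees
    between two types contradicts this. *)

Definition polyfun (K : comNzRingType) (T : Type) (n : nat) (F : T -> 'I_n -> K)
    (q : T -> K) : Prop :=
  exists p : {mpoly K[n]}, forall x, q x = p.@[F x].

Section PolyFun.
Variables (K : comNzRingType) (T : Type) (n : nat) (F : T -> 'I_n -> K).
Implicit Types q : T -> K.

Lemma polyfun_ext q1 q2 : q1 =1 q2 -> polyfun F q1 -> polyfun F q2.
Proof. by move=> e [p hp]; exists p => x; rewrite -e. Qed.

Lemma polyfunC c : polyfun F (fun=> c).
Proof. by exists c%:MP => x; rewrite mevalC. Qed.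

Lemma polyfunX i : polyfun F (F^~ i).
Proof. by exists 'X_i => x; rewrite mevalXU. Qed.

Lemma polyfunD q1 q2 :
  polyfun F q1 -> polyfun F q2 -> polyfun F (fun x => q1 x + q2 x).
Proof. by move=> [p1 h1] [p2 h2]; exists (p1 + p2) => x; rewrite mevalD h1 h2. Qed.

Lemma polyfunM q1 q2 :
  polyfun F q1 -> polyfun F q2 -> polyfun F (fun x => q1 x * q2 x).
Proof. by move=> [p1 h1] [p2 h2]; exists (p1 * p2) => x; rewrite mevalM h1 h2. Qed.

Lemma polyfunN q : polyfun F q -> polyfun F (fun x => - q x).
Proof. by move=> [p hp]; exists (- p) => x; rewrite mevalN hp. Qed.

Lemma polyfunB q1 q2 :
  polyfun F q1 -> polyfun F q2 -> polyfun F (fun x => q1 x - q2 x).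
Proof. by move=> h1 h2; apply/polyfunD/polyfunN. Qed.

Lemma polyfunZ c q : polyfun F q -> polyfun F (fun x => c * q x).
Proof. by apply: polyfunM; apply: polyfunC. Qed.

Lemma polyfun_exp q k : polyfun F q -> polyfun F (fun x => q x ^+ k).
Proof. by move=> [p hp]; exists (p ^+ k) => x; rewrite rmorphXn /= hp. Qed.

Lemma polyfun_sum (I : Type) (s : seq I) (P : pred I) (q : I -> T -> K) :
  (forall i, P i -> polyfun F (q i)) ->
  polyfun F (fun x => \sum_(i <- s | P i) q i x).
Proof.
move=> h; elim: s => [|i s IH].
  by apply: polyfun_ext (polyfunC 0) => x; rewrite big_nil.
case Pi: (P i); last by apply: polyfun_ext IH => x; rewrite big_cons Pi.
by apply: polyfun_ext (polyfunD (h i Pi) IH) => x; rewrite big_cons Pi.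
Qed.

Lemma polyfun_prod (I : Type) (s : seq I) (P : pred I) (q : I -> T -> K) :
  (forall i, P i -> polyfun F (q i)) ->
  polyfun F (fun x => \prod_(i <- s | P i) q i x).
Proof.
move=> h; elim: s => [|i s IH].
  by apply: polyfun_ext (polyfunC 1) => x; rewrite big_nil.
case Pi: (P i); last by apply: polyfun_ext IH => x; rewrite big_cons Pi.
by apply: polyfun_ext (polyfunM (h i Pi) IH) => x; rewrite big_cons Pi.
Qed.

Lemma polyfun_tuple k (q : T -> 'I_k -> K) :
  (forall i, polyfun F (q^~ i)) ->
  exists f : 'I_k -> {mpoly K[n]}, forall x i, q x i = (f i).@[F x].
Proof. by move=> h; case: (fin_all_exists h) => f hf; exists f => x i; apply: hf. Qed.

Lemma polyfun_comp k (G : T -> 'I_k -> K) q :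
  (forall i, polyfun F (G^~ i)) -> polyfun G q -> polyfun F q.
Proof.
move=> /polyfun_tuple [f hf] [p hp]; exists (p \mPo [tuple f i | i < k]) => x.
by rewrite comp_mpoly_meval hp; apply: meval_eq => i; rewrite tnth_mktuple.
Qed.

Definition polyfun_coefs (g : T -> {poly K}) :=
  forall k, polyfun F (fun x => (g x)`_k).

Lemma polyfun_coefs_ext g1 g2 : g1 =1 g2 -> polyfun_coefs g1 -> polyfun_coefs g2.
Proof. by move=> e h k; apply: polyfun_ext (h k) => x; rewrite e. Qed.

Lemma polyfun_coefsC g : polyfun_coefs (fun=> g).
Proof. by move=> k; apply: polyfunC. Qed.

Lemma polyfun_coefs_XsubC q : polyfun F q -> polyfun_coefs (fun x => 'X - (q x)%:P).
Proof.
move=> hq k; apply: (@polyfun_ext (fun x => 'X`_k - q x * (k == 0%N)%:R)).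
  by move=> x; rewrite coefB coefC; case: (k == 0%N); rewrite ?mulr1 ?mulr0.
by apply: polyfunB (polyfunC _) (polyfunM hq (polyfunC _)).
Qed.

Lemma polyfun_coefsM g1 g2 :
  polyfun_coefs g1 -> polyfun_coefs g2 -> polyfun_coefs (fun x => g1 x * g2 x).
Proof.
move=> h1 h2 k.
apply: (@polyfun_ext (fun x => \sum_(i < k.+1) (g1 x)`_i * (g2 x)`_(k - i))).
  by move=> x; rewrite coefM.
by apply: polyfun_sum => i _; apply: polyfunM.
Qed.

Lemma polyfun_coefs_prod (I : Type) (s : seq I) (P : pred I) (g : I -> T -> {poly K}) :
  (forall i, P i -> polyfun_coefs (g i)) ->
  polyfun_coefs (fun x => \prod_(i <- s | P i) g i x).
Proof.
move=> h; elim: s => [|i s IH].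
  by apply: polyfun_coefs_ext (polyfun_coefsC 1) => x; rewrite big_nil.
case Pi: (P i); last by apply: polyfun_coefs_ext IH => x; rewrite big_cons Pi.
by apply: polyfun_coefs_ext (polyfun_coefsM (h i Pi) IH) => x; rewrite big_cons Pi.
Qed.

End PolyFun.

Lemma digits_inj (B n : nat) (f g : 'I_n -> nat) :
  (forall i, f i < B)%N -> (forall i, g i < B)%N ->
  (\sum_i f i * B ^ i = \sum_i g i * B ^ i)%N -> f =1 g.
Proof.
elim: n f g => [f g _ _ _ []//|n IH f g hf hg].
have split_ (u : 'I_n.+1 -> nat) : (\sum_(i < n.+1) u i * B ^ i =
    (\sum_(i < n) u (lift ord0 i) * B ^ i) * B + u ord0)%N.
  rewrite big_ord_recl expn0 muln1 addnC big_distrl /=; congr (_ + _)%N.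
  by apply: eq_bigr => i _; rewrite /bump /= add1n expnSr mulnA.
rewrite !split_ => e.
have e0 : f ord0 = g ord0.
  by have := congr1 (modn^~ B) e; rewrite !modnMDl !modn_small.
move: e; rewrite e0 => /addIn e i.
have B0 : (0 < B)%N by apply: leq_ltn_trans (hf ord0).
case: (unliftP ord0 i) => [j|] -> //; apply: (IH (f \o lift ord0) (g \o lift ord0)) => //=.
by apply/eqP; rewrite -(eqn_pmul2r B0); apply/eqP.
Qed.

(* Kronecker substitution X_i := s ^ (B ^ i), with B larger than all exponents. *)
Lemma mpoly_nonzero_point (K : closedFieldType) (n : nat) (p : {mpoly K[n]}) :
  p != 0 -> exists x : 'I_n -> K, p.@[x] != 0.
Proof.
move=> p0; set B := msize p.
pose e (m : 'X_{1..n}) := (\sum_(i < n) m i * B ^ i)%N.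
pose u : {poly K} := \sum_(m <- msupp p) p@_m *: 'X^(e m).
have hB m : m \in msupp p -> forall i, (m i < B)%N.
  move=> /msize_mdeg_lt hm i; apply: leq_ltn_trans hm; rewrite mdegE.
  by rewrite (bigD1 i) //= leq_addr.
have u0 : u != 0.
  have m0 := mlead_supp p0; apply/eqP => /(congr1 (fun q : {poly K} => q`_(e (mlead p)))).
  rewrite coef0 coef_sum (bigD1_seq _ m0) ?msupp_uniq //= coefZ coefXn eqxx mulr1.
  rewrite big1_seq ?addr0 => [/eqP|m /andP[nm hm]]; first by rewrite mleadc_eq0 (negbTE p0).
  rewrite coefZ coefXn; case: eqP => [em|]; last by rewrite mulr0.
  case/eqP: nm; apply/mnmP; apply: (digits_inj (B := B)); [exact: hB|exact: hB|].
  by rewrite /e in em.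
have [s hs] := closed_nonrootP u u0.
exists (fun i => s ^+ (B ^ i)); apply: contra hs => /eqP hs; rewrite /root -hs mevalE.
rewrite horner_sum; apply/eqP; apply: eq_bigr => m _.
rewrite hornerZ hornerXn; congr (_ * _).
rewrite /e -prodrXr; apply: eq_bigr => i _.
by rewrite -exprM mulnC.
Qed.

Lemma mpoly_eq_points (K : closedFieldType) (n : nat) (p q : {mpoly K[n]}) :
  (forall x : 'rV[K]_n, p.@[x 0] = q.@[x 0]) -> p = q.
Proof.
move=> h; apply/eqP; rewrite -subr_eq0; apply/negPn/negP => /mpoly_nonzero_point [x].
rewrite mevalB -(meval_eq p (v1 := (\row_i x i) 0)); last by move=> i; rewrite mxE.
by rewrite h (meval_eq q (v2 := x)) ?subrr ?eqxx // => i; rewrite mxE.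
Qed.

(** The polynomial ring is a domain, so [pD * pq = 0] with [pD] nonzero forces [pq = 0]. This
    extends identities from generic parameters to all parameters. *)
Lemma polyfun_dense (K : closedFieldType) (n : nat) (D q : 'rV[K]_n -> K) :
  polyfun (fun x : 'rV[K]_n => x 0) D -> polyfun (fun x : 'rV[K]_n => x 0) q ->
  (exists x, D x != 0) -> (forall x, D x != 0 -> q x = 0) -> forall x, q x = 0.
Proof.
move=> [pD hD] [pq hq] [x0 hx0] h x; rewrite hq.
have: pD * pq = 0.
  apply: mpoly_eq_points => y; rewrite mevalM -hD -hq meval0.
  by have [->|/h ->] := eqVneq (D y) 0; rewrite ?mul0r ?mulr0.
move/eqP; rewrite mulf_eq0 => /orP[] /eqP e; last by rewrite e meval0.
by rewrite hD e meval0 eqxx in hx0.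
Qed.

(** * Polynomials whose roots form a linear space *)

Definition roots_poly (K : nzRingType) (R : nat) (z : 'I_R -> K) : {poly K} :=
  \prod_(l < R) ('X - (z l)%:P).

Lemma meval_msym (K : comNzRingType) (n : nat) (s : 'S_n) (p : {mpoly K[n]})
    (z : 'I_n -> K) :
  (msym s p).@[z] = p.@[fun i => z (s i)].
Proof.
have -> : msym s p = p \mPo [tuple 'X_(s i) | i < n].
  by rewrite -(comp_mpoly_id (msym s p)) msym_mPo; congr (_ \mPo _);
     apply: eq_mktuple => i; rewrite tnth_mktuple.
by rewrite comp_mpoly_meval; apply: meval_eq => i; rewrite tnth_mktuple mevalXU.
Qed.

(** Fundamental theorem of symmetric polynomials, with the elementary ones read off from the
    coefficients by Vieta's formulas. *)
Lemma symmetric_polyfun (K : idomainType) (R : nat) (p : {mpoly K[R]}) :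
  p \is symmetric ->
  polyfun (fun (z : 'I_R -> K) (i : 'I_R) => (roots_poly z)`_i) (fun z => p.@[z]).
Proof.
move=> /sym_fundamental [t [<- _]].
apply: (polyfun_comp
  (G := fun (z : 'I_R -> K) (i : 'I_R) => (mesym R K i.+1).@[z])); last first.
  exists t => z; rewrite comp_mpoly_meval; apply: meval_eq => i.
  by rewrite tnth_mktuple.
move=> i; have hi : (R - i.+1 < R)%N by rewrite ltn_subrL /= (leq_ltn_trans _ (ltn_ord i)).
apply: polyfun_ext (polyfunZ ((-1) ^+ i.+1) (polyfunX _ (Ordinal hi))) => z /=.
have := mroots_coeff [tuple z l | l < R] (Ordinal (ltn_ord i : (i.+1 < R.+1)%N)).
rewrite big_tuple; under eq_bigr => l _ do rewrite tnth_mktuple.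
rewrite /= -/(roots_poly z) => ->.
rewrite mulrA -exprD addnn -mul2n exprM sqrrN !expr1n mul1r.
by apply: meval_eq => l; rewrite tnth_mktuple.
Qed.

(** The vector [(1, s, ..., s^(n-1))] works for all but finitely many [s]: a nonzero row of [A i]
    becomes a nonzero polynomial in [s], and finitely many such polynomials have a common
    non-root. *)
Lemma generic_col (K : closedFieldType) (I : finType) (P : pred I) (p n : nat)
    (A : I -> 'M[K]_(p, n)) :
  (forall i, P i -> A i != 0) ->
  exists v : 'cV[K]_n, forall i, P i -> A i *m v != 0.
Proof.
move=> hA; pose vand (s : K) : 'cV_n := \col_j s ^+ j.
have [u hu] : exists u : I -> {poly K}, forall i, P i ->
    u i != 0 /\ forall s, ~~ root (u i) s -> A i *m vand s != 0.
  apply: (@fin_all_exists _ (fun=> _)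
    (fun i u => P i -> u != 0 /\ forall s, ~~ root u s -> A i *m vand s != 0)) => i.
  case Pi: (P i); last by exists 0.
  have [a [b hab]] : exists a, exists b, A i a b != 0.
    have /eqP := hA i Pi; case: (pickP (fun k => A i k.1 k.2 != 0)) => [[a b] h _|h].
      by exists a, b.
    by case; apply/matrixP => a b; rewrite mxE; have /negbFE/eqP := h (a, b).
  exists (rVpoly (row a (A i))) => _; split.
    apply: contra hab => /eqP e; have := congr1 (fun q : {poly K} => q`_b) e.
    by rewrite coef_rVpoly_ord mxE coef0 => ->.
  move=> s; apply: contra => /eqP e.
  rewrite /root (horner_coef_wide _ (size_poly _ _)); apply/eqP.
  have := congr1 (fun w : 'cV_p => w a 0) e; rewrite !mxE; apply: etrans.
  by apply: eq_bigr => j _; rewrite coef_rVpoly_ord !mxE.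
have u0 : \prod_(i | P i) u i != 0.
  by apply/prodf_neq0 => i /hu [].
have [s hs] := closed_nonrootP _ u0.
exists (vand s) => i Pi; apply: (hu i Pi).2; apply: contra hs.
by rewrite /root (bigD1 i) //= hornerM => /eqP ->; rewrite mul0r.
Qed.

Lemma sum_msym_symmetric (K : nzRingType) (n : nat) (p : {mpoly K[n]}) :
  \sum_(s : 'S_n) msym s p \is symmetric.
Proof.
apply/issymP => t; rewrite raddf_sum /= [RHS](reindex_inj (mulIg t)) /=.
by apply: eq_bigr => s _; rewrite msymMm.
Qed.

Lemma prod_msym_symmetric (K : comNzRingType) (n : nat) (p : {mpoly K[n]}) :
  \prod_(s : 'S_n) msym s p \is symmetric.
Proof.
apply/issymP => t; rewrite rmorph_prod /= [RHS](reindex_inj (mulIg t)) /=.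
by apply: eq_bigr => s _; rewrite msymMm.
Qed.

Lemma roots_poly_perm (K : comNzRingType) (R : nat) (z : 'I_R -> K) (s : 'S_R) :
  roots_poly (fun l => z (s l)) = roots_poly z.
Proof. by rewrite /roots_poly [RHS](reindex_inj (@perm_inj _ s)). Qed.

Lemma eq_roots_poly (K : nzRingType) (R : nat) (z1 z2 : 'I_R -> K) :
  z1 =1 z2 -> roots_poly z1 = roots_poly z2.
Proof. by move=> e; apply: eq_bigr => l _; rewrite e. Qed.

Lemma monic_roots_poly (K : closedFieldType) (R : nat) (c : {poly K}) :
  c \is monic -> size c = R.+1 -> exists z : 'I_R -> K, c = roots_poly z.
Proof.
move=> /monicP mc sc; case: (closed_field_poly_normal c) => r; rewrite mc scale1r => e.
have sr : size r = R by apply/eqP; rewrite -eqSS -(size_prod_XsubC r id) -e sc.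
exists (fun l : 'I_R => r`_l); rewrite {1}e (big_nth 0) big_mkord sr.
by [].
Qed.

Definition linform (K : comNzRingType) (n : nat) (u : 'cV[K]_n) : {mpoly K[n]} :=
  \sum_(l < n) u l 0 *: 'X_l.

Lemma linformE (K : comNzRingType) (n : nat) (u : 'cV[K]_n) (z : 'rV[K]_n) :
  (linform u).@[z 0] = (z *m u) 0 0.
Proof.
rewrite /linform raddf_sum mxE /=; apply: eq_bigr => l _.
by rewrite mevalZ mevalXU mulrC.
Qed.

Section LinearRoots.
Variables (K : closedFieldType) (charK : [pchar K] =i pred0).
Variables (m R : nat) (M : 'M[K]_(m, R)).

Definition linear_roots_poly (x : 'rV[K]_m) : {poly K} := roots_poly ((x *m M) 0).

(* The separating f is the product, over all permutations of the roots, of one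
   linear form that vanishes on the row space of M. *)
Lemma linear_roots_poly_closed (c : {poly K}) :
  c \is monic -> size c = R.+1 ->
  (exists x, linear_roots_poly x = c) \/
  exists2 f : {mpoly K[R]}, f.@[fun i => c`_i] != 0 &
    forall x, f.@[fun i => (linear_roots_poly x)`_i] = 0.
Proof.
move=> mc sc; have [z ->] := monic_roots_poly mc sc.
have [/existsP [s /submxP [x ex]]|/existsPn hz] :=
    boolP [exists s : 'S_R, (\row_l z (s l) <= M)%MS].
  left; exists x; rewrite -(roots_poly_perm z s).
  by apply: eq_roots_poly => l; rewrite -ex mxE.
(* [cokermx M] annihilates exactly the row space of [M], so every [A s] is nonzero; one generic [v]
   then detects all the reorderings of [z] simultaneously. *)
right; pose A (s : 'S_R) := (\row_l z (s l)) *m cokermx M.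
have [s _|v hv] := @generic_col K _ predT _ _ A; first by rewrite -submxE hz.
have [f hf] := symmetric_polyfun (prod_msym_symmetric (linform (cokermx M *m v))).
exists f => [|x]; rewrite -hf.
  rewrite rmorph_prod; apply/prodf_neq0 => s _; rewrite /= meval_msym.
  rewrite (meval_eq _ (v2 := (\row_l z (s l)) 0)) => [|i]; last by rewrite mxE.
  rewrite linformE mulmxA; have := hv s isT; apply: contra => /eqP e.
  by apply/eqP/matrixP => i j; rewrite !ord1 [LHS]e mxE.
rewrite rmorph_prod (bigD1 1%g) //= msym1m linformE.
by rewrite -mulmxA [M *m _]mulmxA mulmx_coker mul0mx mulmx0 mxE mul0r.
Qed.

Lemma linear_roots_poly_perm (x x' : 'rV[K]_m) (s : 'S_R) :
  x' *m M = col_perm s (x *m M) -> linear_roots_poly x' = linear_roots_poly x.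
Proof.
move=> e; rewrite /linear_roots_poly -(roots_poly_perm ((x *m M) 0) s).
by apply: eq_roots_poly => l; rewrite e [LHS]mxE.
Qed.

(** For such an [s] one has [col_perm s M = N *m M] for some [N], so the reordering by [s] of the
    roots attached to [x] is the list attached to [x *m N], and both parameters have the same
    polynomial. *)
Definition row_space_perms := [set s : 'S_R | (col_perm s M <= M)%MS].

Lemma row_space_perms_group : group_set row_space_perms.
Proof.
apply/group_setP; split=> [|s t]; first by rewrite inE col_perm1; apply: submx_refl.
rewrite !inE => hs ht; rewrite col_permM.
apply: submx_trans hs.
by rewrite [in X in (X <= _)%MS]col_permE [X in (_ <= X)%MS]col_permE submxMr.
Qed.

(* A rational function on the image: average Q over the permutations of the
   roots with a weight w that vanishes on the permutations moving the row space
   of M; the others do not change the value of Q. *)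
Lemma linear_roots_poly_invariant (Q : {mpoly K[R]}) (D : 'rV[K]_m -> K) :
  polyfun (fun x : 'rV[K]_m => x 0) D -> (exists x, D x != 0) ->
  (forall x x', D x != 0 -> linear_roots_poly x' = linear_roots_poly x ->
     Q.@[(x' *m M) 0] = Q.@[(x *m M) 0]) ->
  exists f1 f2 : {mpoly K[R]},
    (forall x, Q.@[(x *m M) 0] * f2.@[fun i => (linear_roots_poly x)`_i] =
               f1.@[fun i => (linear_roots_poly x)`_i]) /\
    exists x, f2.@[fun i => (linear_roots_poly x)`_i] != 0.
Proof.
move=> pD D0 hQ; pose G := group row_space_perms_group.
have [s|v hv] := @generic_col K _ [pred s | s \notin G] _ _
    (fun s => col_perm s M *m cokermx M).
  by rewrite !inE submxE.
pose lam := linform (cokermx M *m v).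
pose w := \prod_(s | s \notin G) msym s lam.
(* Acting by [s] turns the factor of index [s^-1] of [w] into [lam], which vanishes on the row space
   of [M]. *)
have w_out (x : 'rV_m) s : s \notin G -> (msym s w).@[(x *m M) 0] = 0.
  move=> hs; rewrite /w rmorph_prod /= rmorph_prod.
  rewrite (bigD1 s^-1%g) /=; last by rewrite (groupV G).
  rewrite -msymMm mulVg msym1m linformE -mulmxA [M *m _]mulmxA.
  by rewrite mulmx_coker mul0mx mulmx0 mxE mul0r.
have w_in s : s \in G -> msym s w = w.
  move=> hs; rewrite /w rmorph_prod [RHS](reindex_inj (mulIg s)).
  by apply: eq_big => [t|t _]; [rewrite groupMr | rewrite msymMm].
have wQ (x : 'rV_m) s : s \in G -> D x != 0 ->
    Q.@[fun i => (x *m M) 0 (s i)] = Q.@[(x *m M) 0].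
  rewrite inE => /submxP [N eN] Dx.
  have e : (x *m N) *m M = col_perm s (x *m M).
    by rewrite -mulmxA -eN !col_permE mulmxA.
  rewrite -(hQ x (x *m N) Dx); last exact: linear_roots_poly_perm e.
  by apply: meval_eq => i; rewrite e [RHS]mxE.
have [f1 hf1] := symmetric_polyfun (sum_msym_symmetric (w * Q)).
have [f2 hf2] := symmetric_polyfun (sum_msym_symmetric w).
have f2E x : f2.@[fun i => (linear_roots_poly x)`_i] = w.@[(x *m M) 0] *+ #|G|.
  rewrite -hf2 raddf_sum (bigID (mem G)) /= [X in _ + X]big1 ?addr0 => [|s /w_out//].
  by rewrite (eq_bigr (fun=> w.@[(x *m M) 0])) ?sumr_const // => s /w_in ->.
have f1E (x : 'rV_m) : D x != 0 ->
    f1.@[fun i => (linear_roots_poly x)`_i] = (w.@[(x *m M) 0] * Q.@[(x *m M) 0]) *+ #|G|.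
  move=> Dx; rewrite -hf1 raddf_sum (bigID (mem G)) /=.
  rewrite [X in _ + X]big1 ?addr0 => [|s /w_out hs].
    rewrite (eq_bigr (fun=> w.@[(x *m M) 0] * Q.@[(x *m M) 0])) ?sumr_const // => s hs.
    by rewrite msymM mevalM w_in // meval_msym wQ.
  by rewrite msymM mevalM hs mul0r.
have pM (q : {mpoly K[R]}) : polyfun (fun x : 'rV[K]_m => x 0) (fun x => q.@[(x *m M) 0]).
  apply: (polyfun_comp (G := fun x : 'rV[K]_m => (x *m M) 0)); last by exists q.
  move=> i; apply: polyfun_ext (polyfun_sum _ (fun k _ =>
    polyfunM (polyfunX _ k) (polyfunC _ (M k i)))) => x.
  by rewrite mxE.
have pPhi (q : {mpoly K[R]}) :
    polyfun (fun x : 'rV[K]_m => x 0) (fun x => q.@[fun i => (linear_roots_poly x)`_i]).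
  apply: (polyfun_comp (G := fun (x : 'rV[K]_m) (i : 'I_R) => (linear_roots_poly x)`_i));
    last by exists q.
  have pL : polyfun_coefs (fun x : 'rV[K]_m => x 0) linear_roots_poly;
    last by move=> i; apply: pL.
  apply: polyfun_coefs_prod => l _; apply: polyfun_coefs_XsubC.
  by apply: polyfun_ext (pM 'X_l) => x; rewrite mevalXU.
exists f1, f2; split.
  move=> x; apply/eqP; rewrite -subr_eq0; apply/eqP; move: x.
  apply: (polyfun_dense pD) D0 _ => [|x Dx].
    by apply: polyfunB => //; apply: polyfunM.
  by rewrite f2E f1E // mulrnAr mulrC subrr.
(* A second generic choice, now of the parameter: a point at which no linear factor of [w] vanishes.
   There [f2] takes the value [w] times [#|G|], nonzero in characteristic 0. *)
have [s hs|y hy] := @generic_col K _ [pred s | s \notin G] _ _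
    (fun s => (col_perm s M *m cokermx M *m v)^T).
  by rewrite -trmx0 (inj_eq trmx_inj) hv.
exists y^T; rewrite f2E -mulr_natr mulf_neq0 //; last first.
  by rewrite ((pcharf0P K).1 charK) -lt0n (cardG_gt0 G).
rewrite rmorph_prod; apply/prodf_neq0 => s hs.
rewrite /= meval_msym (meval_eq _ (v2 := (col_perm s (y^T *m M)) 0)) => [|i];
  last by rewrite [RHS]mxE.
rewrite linformE; have := hy s hs; apply: contra => /eqP e.
apply/eqP/matrixP => i j; rewrite !ord1 [RHS]mxE -[RHS]e.
rewrite -[y in LHS]trmxK -trmx_mul mxE.
by rewrite [col_perm s M]col_permE [col_perm s (_ *m _)]col_permE -(mulmxA (M *m _)) !mulmxA.
Qed.
End LinearRoots.

(** * Newton's identities *)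

Section Newton.
Variables (K : comNzRingType) (I : Type) (r : seq I) (P : pred I) (u : I -> K).

(** Its coefficient of index [j] is [(-1)^j] times the elementary symmetric function of degree [j].
    Reversing makes the index equal to the degree, whatever the number of roots. *)
Definition rev_roots_poly : {poly K} := \prod_(i <- r | P i) (1 - (u i)%:P * 'X).

Definition power_sum (k : nat) : K := \sum_(i <- r | P i) u i ^+ k.

End Newton.

(* The logarithmic derivative of the reversed polynomial, truncated at X^N. *)
Lemma newton_truncated (K : comNzRingType) (I : Type) (r : seq I) (P : pred I)
    (u : I -> K) (N : nat) :
  exists H, 'X * (rev_roots_poly r P u)^`() +
    rev_roots_poly r P u * \sum_(k < N) (power_sum r P u k.+1)%:P * 'X^(k.+1) = 'X^(N.+1) * H.
Proof.
elim: r => [|i r [H IH]].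
  exists 0; rewrite /rev_roots_poly /power_sum big_nil derivC !mulr0 big1 ?mulr0 ?addr0 //.
  by move=> k _; rewrite big_nil mul0r.
rewrite /rev_roots_poly /power_sum.
under [\sum_(k < N) _]eq_bigr => k _ do rewrite big_cons.
rewrite big_cons; case: (P i); last by exists H.
set Q := (\prod_(_ <- _ | _) _) in IH *.
exists ((1 - (u i)%:P * 'X) * H - Q * (u i)%:P ^+ N.+1).
under [\sum_(k < N) _]eq_bigr => k _ do rewrite polyCD mulrDl.
rewrite big_split /= derivM derivB derivC derivM derivC derivX.
rewrite /rev_roots_poly -/Q /power_sum in IH.
have geo : (1 - (u i)%:P * 'X) * \sum_(k < N) (u i ^+ k.+1)%:P * 'X^(k.+1) =
    (u i)%:P * 'X - (u i)%:P ^+ N.+1 * 'X^(N.+1).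
  under eq_bigr => k _ do rewrite rmorphXn -exprMn exprS.
  rewrite -mulr_sumr -exprMn exprS; set a := (u i)%:P * 'X.
  transitivity (- a * ((a - 1) * \sum_(k < N) a ^+ k)); first by ring.
  by rewrite -subrX1; ring.
set S1 := \sum_(k < N) _ in IH *; set S2 := \sum_(k < N) _ in geo *.
rewrite -[RHS]addr0 mulrBr [in RHS]mulrCA -IH.
transitivity ((1 - (u i)%:P * 'X) * ('X * Q^`() + Q * S1) - 'X * (u i)%:P * Q
  + Q * ((1 - (u i)%:P * 'X) * S2)); first by ring.
by rewrite geo; ring.
Qed.

(** This is the coefficient of [X^j] in the logarithmic derivative truncated at [j]; the remainder
    begins in degree [j + 1]. *)
Lemma newton_identity (K : comNzRingType) (I : Type) (r : seq I) (P : pred I)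
    (u : I -> K) (j : nat) :
  (rev_roots_poly r P u)`_j *+ j +
    \sum_(i < j) (rev_roots_poly r P u)`_i * power_sum r P u (j - i) = 0.
Proof.
have [H] := newton_truncated r P u j; set Q := rev_roots_poly r P u.
move/(congr1 (fun q : {poly K} => q`_j)).
rewrite coefXnM ltnSn coefD coefXM coef_deriv => e; rewrite -[RHS]e; congr (_ + _).
  by case: (j) => [|j'] //=; rewrite mulr0n.
rewrite coefM big_ord_recr /= subnn coef_sum [X in _ + _ * X]big1 ?mulr0 ?addr0; last first.
  by move=> k _; rewrite coefCM coefXn /= mulr0.
apply: eq_bigr => i _; congr (_ * _); rewrite coef_sum.
have hk : (j - i - 1 < j)%N by rewrite -subnDA ltn_subrL addn1 (leq_ltn_trans _ (ltn_ord i)).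
have hS : (j - i - 1).+1 = (j - i)%N by rewrite subn1 prednK // subn_gt0.
rewrite (bigD1 (Ordinal hk)) //= coefCM coefXn hS eqxx mulr1 big1 ?addr0 // => k nk.
rewrite coefCM coefXn; case: eqP => [ek|]; last by rewrite mulr0.
by case/eqP: nk; apply: val_inj; rewrite /= ek subn1.
Qed.

Lemma rev_roots_poly0 (K : comNzRingType) (I : Type) (r : seq I) (P : pred I) (u : I -> K) :
  (rev_roots_poly r P u)`_0 = 1.
Proof.
rewrite -horner_coef0 /rev_roots_poly horner_prod big1 // => i _.
by rewrite !hornerE subr0.
Qed.

Lemma size_rev_roots_poly (K : comNzRingType) (I : Type) (r : seq I) (P : pred I)
    (u : I -> K) : (size (rev_roots_poly r P u) <= (count P r).+1)%N.
Proof.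
rewrite /rev_roots_poly; elim: r => [|i r IH]; first by rewrite big_nil size_poly1.
rewrite big_cons /=; case: (P i) => //=.
have h : (size (1 - (u i)%:P * 'X : {poly K})%R <= 2)%N.
  apply: leq_trans (size_polyD _ _) _; rewrite geq_max size_poly1 size_polyN /=.
  rewrite mul_polyC; apply: leq_trans (size_scale_leq _ _) _.
  by rewrite size_polyX.
apply: leq_trans (size_polyMleq _ _) _.
by have := leq_add h IH; case: (_ + _)%N.
Qed.

Lemma rev_roots_polyE (K : comNzRingType) (I : Type) (r : seq I) (P : pred I)
    (u : I -> K) (j : nat) : (j <= count P r)%N ->
  (\prod_(i <- r | P i) ('X - (u i)%:P))`_(count P r - j) = (rev_roots_poly r P u)`_j.
Proof.
rewrite /rev_roots_poly.
have hs s : (size (\prod_(i <- s | P i) ('X - (u i)%:P)%R)%R <= (count P s).+1)%N.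
  by rewrite -big_filter -size_filter size_prod_XsubC.
elim: r j => [|i r IH] j; first by rewrite leqn0 => /eqP ->; rewrite !big_nil subnn.
rewrite !big_cons /=; case: (P i) => /=; last by rewrite !add0n; apply: IH.
rewrite add1n !mulrBl mul1r !coefB -mulrA !coefCM coefXM [in RHS]coefXM.
case: j => [|j] hj /=.
  rewrite subn0 /= mulr0 subr0 -(IH 0%N) // subn0.
  by rewrite [X in _ * X]nth_default ?hs // mulr0 subr0.
rewrite subSS -(IH j) // subn_eq0.
have [ej|hj'] := leqP (count P r) j; last by rewrite -(IH j.+1) // subnS.
by rewrite [X in _ = X - _]nth_default ?(leq_trans (size_rev_roots_poly _ _ _)).
Qed.

(** * Varieties isomorphic to an affine space *)

Lemma fractionP (A : idomainType) (u : {fraction A}) :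
  exists a b : A, b != 0 /\ u = tofrac a / tofrac b.
Proof.
elim/quotW: u => x; exists \n_x, \d_x; have dx := denom_ratioP x; split=> //.
have dF : tofrac \d_x != 0 by rewrite tofrac_eq0.
apply: (canRL (mulfK dF)).
unlock FracField.tofrac; rewrite -[LHS]FracField.pi_mul.
apply/eqP; rewrite FracField.equivf_def /FracField.mulf /=.
by rewrite !numden_Ratio ?oner_neq0 ?mulr1 ?mul1r ?mulf_neq0 // mulrC.
Qed.

Section Divisibility.
Variables (K : fieldType) (n : nat).
Implicit Types f g q r : {mpoly K[n]}.

Definition mdivides g f := exists h, f = h * g.

Lemma mdividesD g f1 f2 : mdivides g f1 -> mdivides g f2 -> mdivides g (f1 + f2).
Proof. by move=> [h1 ->] [h2 ->]; exists (h1 + h2); rewrite mulrDl. Qed.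

Lemma mdivides_sum (I : Type) (s : seq I) g (F : I -> {mpoly K[n]}) :
  (forall i, mdivides g (F i)) -> mdivides g (\sum_(i <- s) F i).
Proof.
move=> h; elim: s => [|i s IH]; first by exists 0; rewrite big_nil mul0r.
by rewrite big_cons; apply: mdividesD.
Qed.

(* K[x_1, ..., x_n] is completely integrally closed: comparing leading
   monomials, the leading term of g divides that of f, and subtracting a
   multiple of g from f preserves the hypothesis. *)
Lemma mdivides_almost_integral f g r :
  g != 0 -> r != 0 -> (forall k, mdivides (g ^+ k) (r * f ^+ k)) -> mdivides g f.
Proof.
move=> g0 r0; elim/mleadrect: f => f IH hf.
have [->|f0] := eqVneq f 0; first by exists 0; rewrite mul0r.
have le_gf : (mlead g <= mlead f)%MM.
  apply/mnm_lepP => i; rewrite leqNgt; apply/negP => lt_fg.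
  have [h eh] := hf (mlead r i).+1.
  have h0 : h != 0.
    apply: contraTneq (mulf_neq0 r0 (expf_neq0 (mlead r i).+1 f0)) => h0.
    by rewrite eh h0 mul0r eqxx.
  move/(congr1 (fun q => mlead q i)): eh.
  rewrite !mleadM ?expf_neq0 // !mleadX // !mnmDE !mulmnE => e.
  have : (mlead g i * (mlead r i).+1 <= mlead r i + mlead f i * (mlead r i).+1)%N.
    by rewrite e leq_addl.
  rewrite leqNgt => /negP; apply; apply: leq_trans (leq_mul lt_fg (leqnn _)).
  by rewrite mulSn -addSn.
pose t : {mpoly K[n]} := (f@_(mlead f) / g@_(mlead g)) *: 'X_[(mlead f - mlead g)%MM].
have gc0 : g@_(mlead g) != 0 by rewrite mleadc_eq0.
have X0 : 'X_[(mlead f - mlead g)%MM] != 0 :> {mpoly K[n]} by rewrite -msupp_eq0 msuppX.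
have ltg : mlead (t * g) = mlead f.
  rewrite /t -scalerAl mleadZ ?mulf_neq0 ?invr_neq0 ?mleadc_eq0 //.
  by rewrite mleadM // ?mleadXm ?submK.
have ctg : (t * g)@_(mlead f) = f@_(mlead f).
  have := mleadcM ('X_[(mlead f - mlead g)%MM] : {mpoly K[n]}) g.
  by rewrite mleadXm submK // mcoeffX eqxx mul1r /t -scalerAl mcoeffZ => ->; rewrite divfK.
have [e|f1_neq0] := eqVneq (f - t * g) 0.
  by exists t; apply/eqP; rewrite -subr_eq0 e.
have [h eh] : mdivides g (f - t * g).
  apply: IH => [|k].
    have : (mlead (f - t * g) <= mlead f)%O.
      by apply: le_trans (mleadB_le _ _) _; rewrite ltg joinxx.
    rewrite le_eqVlt => /orP[/eqP e|//].
    by move: f1_neq0; rewrite -mleadc_eq0 e mcoeffB ctg subrr eqxx.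
  rewrite exprBn mulr_sumr; apply: mdivides_sum => i.
  have [h eh] := hf (k - i)%N; have hi : (i <= k)%N by rewrite -ltnS.
  exists ((-1) ^+ i * t ^+ i *+ 'C(k, i) * h).
  rewrite mulrnAr !mulrnAl; congr (_ *+ _).
  transitivity ((-1) ^+ i * t ^+ i * g ^+ i * (r * f ^+ (k - i))).
    by rewrite exprMn; ring.
  have -> : g ^+ k = g ^+ (k - i) * g ^+ i by rewrite -exprD subnK.
  by rewrite eh; ring.
by exists (h + t); rewrite mulrDl -eh subrK.
Qed.
End Divisibility.

(** If [u = a / b] satisfies a monic equation of degree [s], then [b^s] is a common denominator of
    all powers of [u]. Hence [b^k] divides [b^s a^k] for every [k], and complete integral closure
    gives that [b] divides [a]. *)
Lemma mpoly_integrally_closed (K : fieldType) (n : nat) :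
  integrally_closed {mpoly K[n]}.
Proof.
move=> u [p mp pu]; have [a [b [b0 eu]]] := fractionP u.
set s := (size p).-1.
have hu k : exists h : {mpoly K[n]}, tofrac (b ^+ s) * u ^+ k = tofrac h.
  elim/ltn_ind: k => k IH; have [lt_ks|le_sk] := ltnP k s.
    exists (b ^+ (s - k) * a ^+ k); rewrite -(subnK (ltnW lt_ks)) exprD addnK eu.
    rewrite exprMn exprVn !rmorphM /= !rmorphXn /= -!mulrA; congr (_ * _).
    by rewrite mulrCA divff ?mulr1 // expf_eq0 tofrac_eq0 (negbTE b0) andbF.
  have es : u ^+ s = - \sum_(i < s) tofrac p`_i * u ^+ i.
    move/rootP: pu; rewrite (horner_coef_wide _ (size_poly _ _)).
    have sp : size p = s.+1 by rewrite prednK // lt0n size_poly_eq0 monic_neq0.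
    rewrite sp big_ord_recr /= coef_poly ltnSn; move/monicP: mp; rewrite /lead_coef -/s => ->.
    rewrite rmorph1 mul1r addrC => /eqP; rewrite addr_eq0 => /eqP ->; congr (- _).
    by apply: eq_bigr => i _; rewrite coef_poly ltnS ltnW.
  have hi (i : 'I_s) : exists h : {mpoly K[n]}, tofrac (b ^+ s) * u ^+ (k - s + i) = tofrac h.
    by apply: IH; rewrite -[X in (_ < X)%N](subnK le_sk) ltn_add2l.
  have [h eh] := fin_all_exists hi; exists (- \sum_(i < s) p`_i * h i).
  rewrite -[in LHS](subnK le_sk) exprD es !mulrN rmorphN rmorph_sum; congr (- _).
  rewrite !mulr_sumr; apply: eq_bigr => i _; rewrite rmorphM /= -eh exprD; ring.
have [|q eq] := mdivides_almost_integral b0 (expf_neq0 s b0) (f := a) _.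
  move=> k; have [h eh] := hu k; exists h; apply/eqP; rewrite -tofrac_eq; apply/eqP.
  rewrite !rmorphM /= -eh eu !rmorphXn /= exprMn exprVn -!mulrA mulVf ?mulr1 //.
  by rewrite expf_eq0 tofrac_eq0 (negbTE b0) andbF.
by exists q; rewrite eu eq rmorphM mulfK // tofrac_eq0.
Qed.

Lemma comp_mpoly_meval_row (K : fieldType) (n k : nat) (g : 'I_n -> {mpoly K[k]})
    (p : {mpoly K[n]}) (z : 'rV[K]_k) :
  (p \mPo [tuple g i | i < n]).@[z 0] = p.@[(poly_map g z) 0].
Proof.
by rewrite comp_mpoly_meval; apply: meval_eq => i; rewrite tnth_mktuple mxE.
Qed.

Lemma mderivXU (K : fieldType) (n : nat) (i j : 'I_n) :
  ('X_i : {mpoly K[n]})^`M(j) = (i == j)%:R%:MP.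
Proof.
rewrite mderivX mnm1E; case: eqP => [->|_]; last by rewrite scale0r mpolyC0.
have -> : (U_(j) - U_(j) = 0 :> 'X_{1..n})%MM by apply/mnmP => l; rewrite !mnmE subnn.
by rewrite scale1r mpolyX0 mpolyC1.
Qed.

Lemma mderiv_comp (K : fieldType) (n k : nat) (g : 'I_n -> {mpoly K[k]})
    (p : {mpoly K[n]}) (j : 'I_k) :
  (p \mPo [tuple g i | i < n])^`M(j) =
    \sum_(i < n) (p^`M(i) \mPo [tuple g i | i < n]) * (g i)^`M(j).
Proof.
set lg := [tuple g i | i < n].
pose C q := (q \mPo lg)^`M(j) = \sum_(i < n) (q^`M(i) \mPo lg) * (g i)^`M(j).
have CM q1 q2 : C q1 -> C q2 -> C (q1 * q2).
  rewrite /C => h1 h2; rewrite rmorphM /= mderivM h1 h2 mulr_suml mulr_sumr -big_split /=.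
  apply: eq_bigr => i _; rewrite mderivM rmorphD !rmorphM /=; ring.
have CX i : C 'X_i.
  rewrite /C comp_mpolyXU -tnth_nth tnth_mktuple (bigD1 i) //= big1 => [|l nl].
    by rewrite mderivXU eqxx comp_mpolyC mpolyC1 mul1r addr0.
  by rewrite mderivXU eq_sym (negbTE nl) comp_mpolyC mpolyC0 mul0r.
have C1 : C 1.
  rewrite /C rmorph1 -mpolyC1 mderivC big1 // => i _.
  by rewrite mderivC rmorph0 mul0r.
have Cexp q e : C q -> C (q ^+ e).
  by move=> h; elim: e => [|e IH]; rewrite ?expr0 ?exprS //; apply: CM.
have CD q1 q2 : C q1 -> C q2 -> C (q1 + q2).
  rewrite /C => h1 h2; rewrite rmorphD /= mderivD h1 h2 -big_split /=.
  by apply: eq_bigr => i _; rewrite mderivD rmorphD mulrDl.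
have CZ c q : C q -> C (c *: q).
  rewrite /C => h; rewrite linearZ /= mderivZ h scaler_sumr.
  by apply: eq_bigr => i _; rewrite mderivZ linearZ /= scalerAl.
rewrite -/(C p) [p]mpolyE; apply: big_ind => //.
  by rewrite /C !raddf0 big1 // => i _; rewrite !raddf0 mul0r.
move=> m _; apply: CZ; rewrite mpolyXE_id; apply: big_ind => // i _.
by apply: Cexp.
Qed.

(* Counting: there are D ^ (k + 1) monomials with exponents < D in k + 1
   variables, but only O(D ^ k) monomials of degree O(D) in k variables. *)
Lemma mpoly_alg_dependent (K : fieldType) (k : nat) (f : 'I_k.+1 -> {mpoly K[k]}) :
  exists2 P : {mpoly K[k.+1]}, P != 0 & P \mPo [tuple f i | i < k.+1] = 0.
Proof.
(* A monomial with exponents below [D] gives a product of degree at most [(k+1)cD], that is, below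
   [B]. Since [B <= ((k+1)c + 1) D] and [((k+1)c + 1)^k = D - 1], it follows that
   [B^k <= (D - 1) D^k < D^(k+1)]: more products than monomials available to write them. *)
pose c := (\max_i msize (f i)).+1.
pose D := ((k.+1 * c).+1 ^ k).+1.
pose B := (k.+1 * c * D).+1.
pose I := {ffun 'I_k.+1 -> 'I_D}.
pose mon (a : I) : 'X_{1..k.+1} := [multinom (a i : nat) | i < k.+1].
have mon_inj : injective mon.
  move=> a1 a2 e; apply/ffunP => i; apply: val_inj.
  by have := congr1 (fun m : 'X_{1..k.+1} => m i) e; rewrite /mon !mnmE.
pose F (a : I) := 'X_[mon a] \mPo [tuple f i | i < k.+1].
have sF a : (msize (F a) <= B)%N.
  have hle (q1 q2 : {mpoly K[k]}) d1 d2 :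
      (msize q1 <= d1.+1 -> msize q2 <= d2.+1 -> msize (q1 * q2) <= (d1 + d2).+1)%N.
    have [->|n1] := eqVneq q1 0; first by rewrite mul0r msize0.
    have [->|n2] := eqVneq q2 0; first by rewrite mulr0 msize0.
    by move=> h1 h2; rewrite msizeM //; have := leq_add h1 h2; rewrite addnS; case: (_ + _)%N.
  have hx (q : {mpoly K[k]}) d e : (msize q <= d.+1 -> msize (q ^+ e) <= (d * e).+1)%N.
    move=> h; elim: e => [|e IH]; first by rewrite expr0 msize1.
    by rewrite exprS mulnS; apply: hle.
  rewrite /F comp_mpolyX.
  have: (msize (\prod_(i < k.+1) tnth [tuple f i | i < k.+1] i ^+ mon a i)%R
      <= (\sum_(i < k.+1) c * D).+1)%N.
    apply: (big_ind2 (fun (q : {mpoly K[k]}) d => (msize q <= d.+1)%N)).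
    - by rewrite msize1.
    - by move=> q1 d1 q2 d2; apply: hle.
    move=> i _; rewrite tnth_mktuple mnmE.
    apply: leq_trans (hx _ c _ _) _.
      by rewrite /c; do 2 apply: leqW; apply: (leq_bigmax i).
    by rewrite ltnS leq_mul2l ltnW ?orbT.
  by rewrite sum_nat_const card_ord mulnA.
pose A : 'M[K]_(#|{: I}|, #|{: 'X_{1..k < B}}|) :=
  \matrix_(a, j) (F (enum_val a))@_(val (enum_val j : 'X_{1..k < B})).
have ltIJ : (#|{: 'X_{1..k < B}}| < #|{: I}|)%N.
  pose h (m : 'X_{1..k < B}) : {ffun 'I_k -> 'I_B} := [ffun i => inord (m i)].
  have hm (m : 'X_{1..k < B}) i : (m i < B)%N.
    by apply: leq_ltn_trans (bmdeg m); rewrite mdegE (bigD1 i) //= leq_addr.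
  have h_inj : injective h.
    move=> m1 m2 e; apply/val_inj/mnmP => i; have := congr1 (fun u : {ffun _ -> _} => u i) e.
    by rewrite !ffunE => /(congr1 val); rewrite /= !inordK.
  apply: leq_ltn_trans (leq_card _ h_inj) _; rewrite !card_ffun !card_ord.
  have : (B <= (k.+1 * c).+1 * D)%N by rewrite /B [X in (_ <= X)%N]mulSn -add1n leq_add2r.
  move=> hB.
  have hB' : (B ^ k <= ((k.+1 * c).+1 * D) ^ k)%N.
    by case: (posnP k) => [->|k0] //; rewrite leq_exp2r.
  apply: leq_ltn_trans hB' _; rewrite expnMn expnS ltn_mul2r expn_gt0 /=.
  by rewrite /D ltnSn.
have kA : kermx A != 0.
  rewrite -mxrank_eq0 mxrank_ker subn_eq0 -ltnNge.
  exact: leq_ltn_trans (rank_leq_col A) ltIJ.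
have [i0 vi0] : exists i, row i (kermx A) != 0.
  apply/existsP; apply: contraNT kA => /existsPn h.
  by apply/eqP/row_matrixP => i; rewrite row0; apply/eqP/negPn.
set v := row i0 (kermx A) in vi0.
have vA : v *m A = 0 by apply/sub_kermxP; apply: row_sub.
exists (\sum_a v 0 a *: 'X_[mon (enum_val a)]).
  apply: contra vi0 => /eqP e; apply/eqP/rowP => a; rewrite [RHS]mxE.
  have := congr1 (fun q => q@_(mon (enum_val a))) e; rewrite mcoeff0 raddf_sum /=.
  rewrite (bigD1 a) //= mcoeffZ mcoeffX eqxx mulr1 big1 ?addr0 // => b nb.
  rewrite mcoeffZ mcoeffX; case: eqP => [/mon_inj/enum_val_inj eb|]; last by rewrite mulr0.
  by rewrite eb eqxx in nb.
rewrite (raddf_sum (comp_mpoly [tuple f i | i < k.+1])) /=.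
apply/mpolyP => m; rewrite mcoeff0 raddf_sum /=.
have [ltm|gem] := ltnP (mdeg m) B.
  have := congr1 (fun w : 'rV_ _ => w 0 (enum_rank (BMultinom ltm))) vA.
  rewrite !mxE; apply: etrans; apply: eq_bigr => a _.
  by rewrite [A _ _]mxE enum_rankK comp_mpolyZ mcoeffZ.
rewrite big1 // => a _; rewrite comp_mpolyZ mcoeffZ memN_msupp_eq0 ?mulr0 //.
by apply: msize_mdeg_ge; apply: leq_trans (sF _) gem.
Qed.

Section IsoAffineSpace.
Variables (K : closedFieldType) (n k : nat) (Y : 'rV[K]_n -> Prop).
Hypothesis Y_iso : isomorphic_varieties Y (@affine_space K k).

Lemma iso_affine_normal : normal_variety Y.
Proof.
have [f [g [_ gY gfK fgK]]] := Y_iso.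
exists {mpoly K[k]}, (comp_mpoly [tuple g i | i < n]).
split; last exact: mpoly_integrally_closed.
split=> [b|p].
  exists (b \mPo [tuple f i | i < k]); apply: mpoly_eq_points => z.
  by rewrite /= !comp_mpoly_meval_row fgK.
split=> [e y Yy|Yp].
  by rewrite -(gfK y Yy) -comp_mpoly_meval_row [_ \mPo _]e meval0.
apply: mpoly_eq_points => z; rewrite /= comp_mpoly_meval_row meval0.
exact/Yp/gY.
Qed.

Lemma iso_affine_dimension : has_dimension Y k.
Proof.
have [f [g [_ gY gfK fgK]]] := Y_iso; split.
  exists f => P hP; apply: mpoly_eq_points => z.
  by rewrite meval0 -[z in LHS]fgK // hP //; apply: gY.
move=> u hu.
have [P /eqP P0 hP] := mpoly_alg_dependent (fun i => u i \mPo [tuple g i | i < n]).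
apply/P0/hu => y Yy; have := congr1 (fun q => q.@[(poly_map f y) 0]) hP.
rewrite meval0 comp_mpoly_meval_row; apply: etrans; apply: meval_eq => i.
by rewrite !mxE comp_mpoly_meval_row gfK.
Qed.

(** The tangent space at [y] is the image of the differential [J] of [g]. The latter is injective
    because [f] after [g] is the identity, whence [J *m F = 1]. Conversely, a tangent vector [v]
    tested on the equations [X_i - g_i(f)] of [Y] satisfies [v = v *m F *m J]. *)
Lemma iso_affine_smooth : smooth_variety Y.
Proof.
exists k; split; first exact: iso_affine_dimension.
have [f [g [_ gY gfK fgK]]] := Y_iso => y Yy.
pose z := poly_map f y.
pose J : 'M[K]_(k, n) := \matrix_(j, i) ((g i)^`M(j)).@[z 0].
pose F : 'M[K]_(n, k) := \matrix_(i, j) ((f j)^`M(i)).@[y 0].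
have gz : poly_map g z = y by apply: gfK.
have chain_g (p : {mpoly K[n]}) j : ((p \mPo [tuple g i | i < n])^`M(j)).@[z 0] =
    \sum_i (p^`M(i)).@[y 0] * J j i.
  rewrite mderiv_comp raddf_sum /=; apply: eq_bigr => i _.
  by rewrite mevalM comp_mpoly_meval_row gz mxE.
have chain_f (p : {mpoly K[k]}) j : ((p \mPo [tuple f i | i < k])^`M(j)).@[y 0] =
    \sum_i (p^`M(i)).@[z 0] * F j i.
  rewrite mderiv_comp raddf_sum /=; apply: eq_bigr => i _.
  by rewrite mevalM comp_mpoly_meval_row mxE.
have JF : J *m F = 1%:M.
  apply/matrixP => j l; rewrite !mxE.
  have e : f l \mPo [tuple g i | i < n] = 'X_l.
    apply: mpoly_eq_points => x; rewrite comp_mpoly_meval_row mevalXU.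
    by rewrite -[x in RHS]fgK // mxE.
  have := congr1 (fun q => (q^`M(j)).@[z 0]) e.
  rewrite /= chain_g mderivXU mevalC eq_sym => <-.
  by apply: eq_bigr => i _; rewrite [F i l]mxE mulrC.
pose L := linfun (mulmxr J : 'rV[K]_k -> 'rV[K]_n).
exists (limg L); split.
  rewrite limg_dim_eq ?dimvf ?dim_matrix; first by rewrite mul1r.
  apply/eqP; rewrite -subv0; apply/subvP => w; rewrite capfv memv_ker lfunE /= memv0.
  by move=> /eqP wJ; rewrite -[w]mulmx1 -JF mulmxA wJ mul0mx.
move=> v; split.
  move/memv_imgP => [w _ ->] p Yp; rewrite lfunE /=.
  have p0 : p \mPo [tuple g i | i < n] = 0.
    by apply: mpoly_eq_points => x; rewrite comp_mpoly_meval_row meval0; apply/Yp/gY.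
  under eq_bigr => i _ do rewrite mxE mulr_sumr.
  rewrite exchange_big big1 // => j _.
  have := chain_g p j; rewrite p0 linear0 meval0 => e.
  transitivity (w 0 j * \sum_i (p^`M(i)).@[y 0] * J j i); last by rewrite -e mulr0.
  by rewrite mulr_sumr; apply: eq_bigr => i _; rewrite mulrCA.
move=> tv; apply/memv_imgP; exists (v *m F); rewrite ?memvf // lfunE /=.
apply/rowP => i.
have -> : v 0 i = \sum_l ('X_i^`M(l)).@[y 0] * v 0 l.
  rewrite (bigD1 i) //= big1 => [|l nl]; rewrite mderivXU mevalC ?eqxx ?mul1r ?addr0 //.
  by rewrite eq_sym (negbTE nl) mul0r.
have /tv : vanishes_on Y ('X_i - (g i \mPo [tuple f j | j < k])).
  move=> x Yx; rewrite mevalB mevalXU comp_mpoly_meval_row.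
  by have := congr1 (fun w : 'rV_n => w 0 i) (gfK x Yx); rewrite mxE => ->; rewrite subrr.
under eq_bigr => l _ do rewrite mderivB mevalB mulrBl chain_f.
rewrite sumrB => /eqP; rewrite subr_eq0 => /eqP ->.
under eq_bigr => l _ do rewrite mulr_suml.
rewrite exchange_big mxE; apply: eq_bigr => j _.
rewrite !mxE mulr_suml; apply: eq_bigr => l _; rewrite !mxE; ring.
Qed.
End IsoAffineSpace.

(** * Images of affine spaces *)

(** Denominators are cleared by [b ^+ size p], one power more than the degree requires; the extra
    factor is harmless in a domain. *)
Lemma integral_fraction (A : idomainType) (p : {poly A}) (a b : A) :
  b != 0 -> p \is monic ->
  \sum_(i < size p) p`_i * a ^+ i * b ^+ (size p - i) = 0 ->
  integralOver (@tofrac A) (tofrac a / tofrac b).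
Proof.
move=> b0 mp e; exists p => //; have bF : tofrac b != 0 by rewrite tofrac_eq0.
rewrite /root (horner_coef_wide _ (size_poly _ _)).
rewrite -(inj_eq (mulfI (expf_neq0 (size p) bF))) mulr0.
move/(congr1 (@tofrac A)): e; rewrite tofrac0 rmorph_sum => e.
rewrite -[X in _ == X]e mulr_sumr; apply/eqP; apply: eq_bigr => i _.
rewrite coef_poly ltn_ord !rmorphM !rmorphXn /= exprMn exprVn.
have -> : tofrac b ^+ size p = tofrac b ^+ (size p - i) * tofrac b ^+ i.
  by rewrite -exprD subnK // ltnW.
rewrite [RHS]mulrC -!mulrA; congr (_ * _).
by rewrite mulrCA [_ ^+ i * (_ / _)]mulrCA divff ?mulr1 // expf_neq0.
Qed.

(** A polynomial vanishes on the image of [F] exactly when its pullback is 0, so [phi] and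
    composition with [F] have the same kernel. The integral equation of [q], multiplied by powers of
    the pullback of [f2], can therefore be moved to [A], where normality makes the fraction
    [f1 / f2] an element. *)
Lemma normal_image_polyfun (K : closedFieldType) (n k : nat) (Y : 'rV[K]_n -> Prop)
    (F : 'I_n -> {mpoly K[k]}) (q : {mpoly K[k]}) (f1 f2 : {mpoly K[n]}) :
  (forall y, Y y <-> exists x, y = poly_map F x) ->
  normal_variety Y ->
  integralOver (comp_mpoly [tuple F i | i < n]) q ->
  q * (f2 \mPo [tuple F i | i < n]) = f1 \mPo [tuple F i | i < n] ->
  f2 \mPo [tuple F i | i < n] != 0 ->
  exists f, q = f \mPo [tuple F i | i < n].
Proof.
set lF := [tuple F i | i < n] => Yimg [A [phi [[phi_surj phi_ker] Anorm]]].
move=> [p mp pq] e12 f2_neq0.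
have ker0 s : phi s = 0 <-> s \mPo lF = 0.
  rewrite phi_ker; split=> [h|h y /Yimg [x ->]].
    apply: mpoly_eq_points => x; rewrite comp_mpoly_meval_row meval0.
    by apply/h/Yimg; exists x.
  by rewrite -comp_mpoly_meval_row h meval0.
have phi2 : phi f2 != 0 by apply: contra f2_neq0 => /eqP /ker0 ->.
have [|b eb] := Anorm (tofrac (phi f1) / tofrac (phi f2)).
  have szp : size (map_poly phi p) = size p.
    by rewrite size_map_poly_id0 // (monicP mp) rmorph1 oner_neq0.
  apply: (integral_fraction (p := map_poly phi p)) => //; first exact: monic_map.
  rewrite szp.
  have /ker0 : (\sum_(i < size p) p`_i * f1 ^+ i * f2 ^+ (size p - i)) \mPo lF = 0.
    rewrite raddf_sum /=; move: pq.
    rewrite /root (horner_coef_wide _ (size_poly _ _)) => /eqP pq.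
    rewrite -[RHS](mulr0 ((f2 \mPo lF) ^+ size p)) -[X in _ = _ * X]pq mulr_sumr.
    apply: eq_bigr => i _; rewrite coef_poly ltn_ord !rmorphM !rmorphXn /= -e12 exprMn.
    have -> : (f2 \mPo lF) ^+ size p = (f2 \mPo lF) ^+ (size p - i) * (f2 \mPo lF) ^+ i.
      by rewrite -exprD subnK // ltnW.
    by ring.
  rewrite rmorph_sum => e; rewrite -[RHS]e; apply: eq_bigr => i _.
  by rewrite coef_map !rmorphM !rmorphXn.
have [f ef] := phi_surj b; exists f.
apply: (mulIf f2_neq0); rewrite e12; apply/eqP; rewrite -subr_eq0 -rmorphM -rmorphB.
apply/eqP/ker0; rewrite rmorphB rmorphM /= ef; apply/eqP.
rewrite subr_eq0 -tofrac_eq rmorphM /= -eb.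
by rewrite divfK // tofrac_eq0.
Qed.

(** * Necklaces *)

Section Words.
Variables (d : nat) (d_gt0 : (0 < d)%N).
Implicit Types (u v w : word d) (nu : necklace d) (S : {set 'I_d}).

(* Words of length d as d-periodic functions on the natural numbers. *)
Definition letter w (n : nat) : bool := nth false w (n %% d).

Lemma letter_modn w n : letter w (n %% d) = letter w n.
Proof. by rewrite /letter modn_mod. Qed.

Lemma letter_inj u w : letter u =1 letter w -> u = w.
Proof.
move=> e; apply: eq_from_tnth => i; rewrite !(tnth_nth false).
by have := e i; rewrite /letter modn_small.
Qed.

Lemma letter_rot w (k n : nat) : (k < d)%N -> letter [tuple of rot k w] n = letter w (n + k).
Proof.
move=> ltkd; rewrite /letter /= nth_cat size_drop size_tuple nth_drop.
rewrite -modnDml.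
move: (n %% d)%N (ltn_pmod n d_gt0) => q ltqd; case: ifP => h.
  by rewrite addnC [in RHS]modn_small //; lia.
rewrite nth_take; last by lia.
have -> : (q + k = (q - (d - k)) + d)%N by lia.
by rewrite modnDr modn_small //; lia.
Qed.

Lemma rotationsP u w :
  reflect (exists k, forall n, letter u n = letter w (n + k)) (u \in rotations w).
Proof.
apply: (iffP imsetP) => [[k _ ->]|[k h]].
  by exists k => n; rewrite letter_rot.
exists (Ordinal (ltn_pmod k d_gt0)) => //; apply: letter_inj => n.
by rewrite h letter_rot ?ltn_pmod //= -letter_modn -[in RHS]letter_modn modnDmr.
Qed.

Lemma rotations_sym u w : u \in rotations w -> w \in rotations u.
Proof.
move=> /rotationsP [k h]; apply/rotationsP; exists (d - k %% d)%N => n.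
rewrite h -[RHS]letter_modn -addnA -modnDmr.
have -> : ((d - k %% d + k) %% d = 0)%N.
  rewrite -modnDmr subnK ?modnn //; exact/ltnW/ltn_pmod.
by rewrite addn0 letter_modn.
Qed.

Lemma rotations_trans u v w : u \in rotations v -> v \in rotations w -> u \in rotations w.
Proof.
move=> /rotationsP [k h] /rotationsP [l h']; apply/rotationsP; exists (k + l)%N => n.
by rewrite h h' addnA.
Qed.

Lemma necklaceE nu w : w \in val nu -> val nu = rotations w.
Proof.
have /existsP [w0 /eqP ->] := valP nu => hw; apply/setP => u; apply/idP/idP => hu.
  exact: rotations_trans hu (rotations_sym hw).
exact: rotations_trans hu hw.
Qed.

Lemma necklace_wordP nu : val nu = rotations (necklace_word nu).
Proof. exact/eqP/(xchooseP (existsP (valP nu))). Qed.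

Lemma eq_necklace nu nu' w : w \in val nu -> w \in val nu' -> nu = nu'.
Proof. by move=> h h'; apply: val_inj; rewrite (necklaceE h) (necklaceE h'). Qed.

Lemma weightE nu S : represents S nu -> weight nu = #|S|.
Proof.
rewrite /represents necklace_wordP => /imsetP [k _ /(congr1 val) /= e].
rewrite /weight -(seq.permP (_ : perm_eq (rot k (necklace_word nu)) _) id) ?perm_rot //.
rewrite -e /= count_map cardE /enum_mem size_filter.
by rewrite -enumT filter_predT; apply: eq_count.
Qed.

Definition mem_mod S (n : nat) : bool := letter [tuple i \in S | i < d] n.

Lemma mem_mod_ord S (i : 'I_d) : mem_mod S i = (i \in S).
Proof. by rewrite /mem_mod /letter modn_small // -tnth_nth tnth_mktuple. Qed.

Lemma mem_mod_modn S n : mem_mod S (n %% d) = mem_mod S n.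
Proof. exact: letter_modn. Qed.

Definition shift_stab S (k : nat) := [forall i : 'I_d, mem_mod S (i + k) == mem_mod S i].

Lemma shift_stabP S k :
  reflect (forall n, mem_mod S (n + k) = mem_mod S n) (shift_stab S k).
Proof.
apply: (iffP forallP) => h n; last by rewrite h.
have /eqP := h (Ordinal (ltn_pmod n d_gt0)).
by rewrite /= mem_mod_modn -mem_mod_modn modnDml mem_mod_modn.
Qed.

Lemma stab_orderE nu S : represents S nu ->
  stab_order nu = #|[set k : 'I_d | shift_stab S k]|.
Proof.
rewrite /represents necklace_wordP => /imsetP [j _ /(congr1 val) /= e].
apply: eq_card => k; rewrite !inE; apply/eqP/shift_stabP => [h n|h].
  rewrite /mem_mod -letter_rot //; congr (letter _ n); apply: val_inj; rewrite /= e.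
  by rewrite rot_rot h.
apply: (@rot_inj j); rewrite rot_rot -e.
suff /(congr1 val) : [tuple of rot k [tuple i \in S | i < d]] = [tuple i \in S | i < d] by [].
apply: letter_inj => n; rewrite letter_rot //; exact: h.
Qed.

Lemma necklace_shift nu nu' S S' k : represents S nu -> represents S' nu' ->
  (forall n, mem_mod S (n + k) = mem_mod S' n) -> nu = nu'.
Proof.
move=> hS hS' h; apply: (@eq_necklace nu nu' [tuple i \in S' | i < d]) => //.
by rewrite (necklaceE hS); apply/rotationsP; exists k => n; exact/esym/h.
Qed.

Lemma stab_order_gt0 nu : (0 < stab_order nu)%N.
Proof.
apply/card_gt0P; exists (Ordinal d_gt0); rewrite inE /=; apply/eqP; exact: rot0.
Qed.

Definition shift_ord (k : nat) (i : 'I_d) : 'I_d := Ordinal (ltn_pmod (i + k) d_gt0).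

Lemma shift_ord_inj k : injective (shift_ord k).
Proof.
move=> i j /(congr1 val) /= /eqP; rewrite eqn_modDr !modn_small // => /eqP.
exact: val_inj.
Qed.

Variables (K : fieldType) (zeta : K).
Hypothesis zeta_prim : d.-primitive_root zeta.

Lemma zeta_modn n : zeta ^+ (n %% d) = zeta ^+ n.
Proof. exact: prim_expr_mod. Qed.

Lemma zeta_neq0 : zeta != 0.
Proof.
apply/eqP => z0; have /eqP := prim_expr_order zeta_prim.
by rewrite z0 expr0n eqn0Ngt d_gt0 eq_sym oner_eq0.
Qed.

(** Lagrange's argument: translation by [k] permutes the stabilizer and multiplies the product of
    the [zeta ^+ j] over it by [zeta ^+ (k * stab_order nu)]. *)
Lemma stab_order_expr nu S k : represents S nu -> shift_stab S k ->
  zeta ^+ (k * stab_order nu) = 1.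
Proof.
move=> hS /shift_stabP hk; set H := [set j : 'I_d | shift_stab S j].
have P0 : \prod_(j in H) zeta ^+ j != 0.
  by apply/prodf_neq0 => j _; rewrite expf_neq0 // zeta_neq0.
apply: (mulfI P0); rewrite mulr1 (stab_orderE hS) -/H.
rewrite exprM -prodr_const -big_split /= [RHS](reindex_inj (@shift_ord_inj k)).
apply: eq_big => [j|j _]; last by rewrite zeta_modn exprD.
rewrite !inE; apply/shift_stabP/shift_stabP => h n /=.
  by rewrite -mem_mod_modn modnDmr mem_mod_modn addnA hk.
by rewrite -hk -[RHS]h -mem_mod_modn -[RHS]mem_mod_modn -addnA modnDmr.
Qed.

(** The stabilizer provides [stab_order nu] distinct roots of unity of exponent [stab_order nu], so
    one of them is primitive. *)
Lemma stab_primitive nu S : represents S nu ->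
  exists2 k, shift_stab S k & (stab_order nu).-primitive_root (zeta ^+ k).
Proof.
move=> hS; pose H := [set j : 'I_d | shift_stab S j].
pose rs := [seq zeta ^+ (j : 'I_d) | j <- enum H].
have : has (stab_order nu).-primitive_root rs.
  apply: has_prim_root (stab_order_gt0 nu) _ _ _.
  - apply/allP => _ /mapP [j + ->]; rewrite mem_enum inE => hj.
    by apply/unity_rootP; rewrite -exprM; apply: stab_order_expr hj.
  - rewrite map_inj_uniq ?enum_uniq // => i j /eqP.
    by rewrite (eq_prim_root_expr zeta_prim) !modn_small // => /eqP /val_inj.
  by rewrite size_map -cardE (stab_orderE hS).
case/hasP => _ /mapP [j + ->]; rewrite mem_enum inE => hj hp.
by exists j.
Qed.

Lemma fourier_shift S k e : shift_stab S k ->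
  zeta ^+ (k * e) * fourier zeta S e = fourier zeta S e.
Proof.
move=> /shift_stabP hk; rewrite /fourier mulr_sumr.
rewrite [RHS](reindex_inj (@shift_ord_inj k)) /=.
apply: eq_big => [j|j _].
  by rewrite -!mem_mod_ord /= mem_mod_modn hk.
rewrite -exprD [RHS]exprM zeta_modn -exprM; congr (_ ^+ _); lia.
Qed.

(** Translating [S] by a stabilizing [k] multiplies the sum by [(zeta ^+ k) ^+ e]; for primitive
    [zeta ^+ k] this factor differs from 1 unless the stabilizer order divides [e]. *)
Lemma fourier_eq0 nu S e : represents S nu -> ~~ (stab_order nu %| e)%N ->
  fourier zeta S e = 0.
Proof.
move=> hS he; have [k hk hp] := stab_primitive hS; apply/eqP.
have /eqP := fourier_shift e hk; rewrite -subr_eq0 -[X in _ - X]mul1r -mulrBl mulf_eq0.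
by rewrite exprM subr_eq0 -(prim_order_dvd hp) (negbTE he).
Qed.

End Words.

(** * The parametrization by block representatives *)

Lemma count_index_enum (T : finType) (P : pred T) : count P (index_enum T) = #|P|.
Proof. by rewrite -sum1_count -sum1_card. Qed.

Lemma power_sumE (K : comNzRingType) (I : Type) (r : seq I) (P : pred I) (u : I -> K) j :
  (0 < j)%N ->
  power_sum r P u j = - ((rev_roots_poly r P u)`_j *+ j +
    \sum_(i < j.-1) (rev_roots_poly r P u)`_i.+1 * power_sum r P u (j - i.+1)).
Proof.
case: j => // j _; have := newton_identity r P u j.+1.
rewrite big_ord_recl rev_roots_poly0 mul1r subn0 addrCA => /eqP.
by rewrite addr_eq0 => /eqP.
Qed.

Section PolyfunNewton.
Variables (K : closedFieldType) (charK : [pchar K] =i pred0).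
Variables (T : Type) (n : nat) (F : T -> 'I_n -> K).
Variables (I : Type) (r : seq I) (P : pred I) (u : T -> I -> K).

Lemma natr_neq0 j : (0 < j)%N -> j%:R != 0 :> K.
Proof. by move=> j0; rewrite ((pcharf0P K).1 charK) -lt0n. Qed.

Lemma polyfun_power_sum j : (0 < j)%N ->
  (forall i, (i <= j)%N -> polyfun F (fun x => (rev_roots_poly r P (u x))`_i)) ->
  polyfun F (fun x => power_sum r P (u x) j).
Proof.
elim/ltn_ind: j => j IH j0 hE.
apply: polyfun_ext (fun x => esym (power_sumE r P (u x) j0)) _.
apply: polyfunN; apply: polyfunD.
  by apply: polyfun_ext (polyfunZ j%:R (hE j (leqnn j))) => x; rewrite mulr_natl.
apply: polyfun_sum => i _; have hi := ltn_ord i.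
apply: polyfunM; first by apply: hE; lia.
apply: IH; [lia|lia|move=> l hl; apply: hE; lia].
Qed.

(** This combination involves only coefficients of index below [j]. Once the power sum of degree [j]
    is known, the coefficient can be solved for, since [j] is invertible. *)
Lemma polyfun_newton_step j : (0 < j)%N ->
  (forall i, (i < j)%N -> polyfun F (fun x => (rev_roots_poly r P (u x))`_i)) ->
  polyfun F (fun x => power_sum r P (u x) j + (rev_roots_poly r P (u x))`_j *+ j).
Proof.
move=> j0 hE.
apply: (@polyfun_ext _ _ _ _ (fun x => - \sum_(i < j.-1)
    (rev_roots_poly r P (u x))`_i.+1 * power_sum r P (u x) (j - i.+1))).
  by move=> x; rewrite [in RHS]power_sumE // opprD addrAC addNr add0r.
apply: polyfunN; apply: polyfun_sum => i _; have hi := ltn_ord i.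
apply: polyfunM; first by apply: hE; lia.
by apply: polyfun_power_sum; [lia|move=> l hl; apply: hE; lia].
Qed.

Lemma polyfun_rev_roots j :
  (forall i, (0 < i <= j)%N -> polyfun F (fun x => power_sum r P (u x) i)) ->
  polyfun F (fun x => (rev_roots_poly r P (u x))`_j).
Proof.
elim/ltn_ind: j => j IH hP; have [->|j0] := posnP j.
  by apply: polyfun_ext (polyfunC F 1) => x; rewrite rev_roots_poly0.
have h : polyfun F (fun x => power_sum r P (u x) j + (rev_roots_poly r P (u x))`_j *+ j).
  by apply: polyfun_newton_step => // i hi; apply: IH => // l hl; apply: hP; lia.
have hPj : polyfun F (fun x => power_sum r P (u x) j) by apply: hP; rewrite j0 leqnn.
apply: polyfun_ext (polyfunZ j%:R^-1 (polyfunB h hPj)) => x.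
by rewrite [X in X - _]addrC addrK -[X in _ * X]mulr_natl mulKf // natr_neq0.
Qed.

End PolyfunNewton.

Lemma closed_root (K : closedFieldType) (h : nat) (w : K) :
  (0 < h)%N -> exists y, y ^+ h = w.
Proof.
move=> h0; have : size ('X^h - w%:P : {poly K}) != 1%N by rewrite size_XnsubC // eqSS -lt0n.
by move/closed_rootP => [y]; rewrite /root !hornerE subr_eq0 => /eqP; exists y.
Qed.

Lemma closed_prim_root (K : closedFieldType) (charK : [pchar K] =i pred0) (n : nat) :
  (0 < n)%N -> exists z : K, n.-primitive_root z.
Proof.
move=> n0; have [rs e] := closed_field_poly_normal ('X^n - 1 : {poly K}).
rewrite lead_coefXnsubC // scale1r in e.
have n1 : n%:R != 0 :> K by apply: natr_neq0.
have urs : uniq rs.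
  by rewrite -separable_prod_XsubC -e separable_Xn_sub_1.
have srs : size rs = n.
  by apply/eqP; rewrite -eqSS -(size_prod_XsubC rs id) -e size_XnsubC.
have : has n.-primitive_root rs.
  apply: has_prim_root; rewrite ?srs //; apply/allP => z zrs.
  by rewrite /root_of_unity e root_prod_XsubC.
by case/hasP => z _; exists z.
Qed.

Lemma mevalXn (K : comNzRingType) (n : nat) (v : 'I_n -> K) (p : {mpoly K[n]}) k :
  (p ^+ k).@[v] = p.@[v] ^+ k.
Proof. exact: rmorphXn. Qed.

Lemma meval_sum (K : comNzRingType) (n : nat) (v : 'I_n -> K) (I : Type) (r : seq I)
    (P : pred I) (F : I -> {mpoly K[n]}) :
  (\sum_(i <- r | P i) F i).@[v] = \sum_(i <- r | P i) (F i).@[v].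
Proof. exact: raddf_sum. Qed.

Lemma poly_eq_points (K : closedFieldType) (p q : {poly K}) :
  (forall t, p.[t] = q.[t]) -> p = q.
Proof.
move=> e; apply/eqP; rewrite -subr_eq0; apply/negPn/negP => /closed_nonrootP [t].
by rewrite /root hornerD hornerN e subrr eqxx.
Qed.

(** Compare the coefficients of [t^k], where a monomial of [f] contributes in the degree given by
    its weight. A monomial of weight [k] containing a variable of smaller weight vanishes at [y]. In
    any other one all variables have weight at least [k > 0], which leaves room for a single
    variable. *)
Lemma weighted_linear_part (K : closedFieldType) (n : nat) (f : {mpoly K[n]})
    (w : 'I_n -> nat) (y : 'I_n -> K) (k : nat) (c : K) :
  (0 < k)%N -> (forall l, (w l < k)%N -> y l = 0) ->
  (forall t, f.@[fun l => t ^+ w l * y l] = c * t ^+ k) ->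
  c = \sum_(l | w l == k) f@_U_(l) * y l.
Proof.
move=> k0 y0 hf.
pose wt (mon : 'X_{1..n}) := (\sum_l w l * mon l)%N.
pose u : {poly K} := \sum_(mon <- msupp f) (f@_mon * \prod_l y l ^+ mon l) *: 'X^(wt mon).
have eu : u = c *: 'X^k.
  apply: poly_eq_points => t; rewrite hornerZ hornerXn -hf mevalE horner_sum.
  apply: eq_bigr => mon _; rewrite hornerZ hornerXn -mulrA; congr (_ * _).
  rewrite /wt -prodrXr -big_split /=; apply: eq_bigr => l _.
  by rewrite exprMn -exprM mulrC.
have -> : c = u`_k by rewrite eu coefZ coefXn eqxx mulr1.
have monE (mon : 'X_{1..n}) : (\prod_l y l ^+ mon l) * (k == wt mon)%:R =
    \sum_(l | w l == k) (mon == U_(l)%MM)%:R * y l.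
  have wtU l : wt U_(l)%MM = w l.
    rewrite /wt (bigD1 l) //= mnm1E eqxx muln1 big1 ?addn0 // => l' nl.
    by rewrite mnm1E eq_sym (negbTE nl) muln0.
  have [ek|nk] := eqVneq k (wt mon); last first.
    rewrite mulr0 big1 // => l /eqP wl; case: eqP => [em|]; last by rewrite mul0r.
    by rewrite em wtU wl eqxx in nk.
  rewrite mulr1; have [/existsP [l /andP[ml lt_lk]]|/existsPn none] :=
      boolP [exists l, (0 < mon l)%N && (w l < k)%N].
    rewrite (bigD1 l) //= y0 // expr0n eqn0Ngt ml mul0r big1 // => l' /eqP wl'.
    case: eqP => [em|]; last by rewrite mul0r.
    by move: ml; rewrite em mnm1E lt0b => /eqP el; rewrite -el wl' ltnn in lt_lk.
  have [l ml] : exists l, (0 < mon l)%N.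
    apply/existsP; rewrite -[[exists _, _]]negbK; apply/negP => /existsPn h0.
    move: k0; rewrite ek /wt big1 // => l _; have := h0 l; rewrite -eqn0Ngt => /eqP ->.
    by rewrite muln0.
  have wlk : (k <= w l)%N by have := none l; rewrite ml -leqNgt.
  have wtD : (k = w l * mon l + \sum_(l' | l' != l) w l' * mon l')%N.
    by rewrite [LHS]ek /wt (bigD1 l).
  have ml1 : mon l = 1%N by nia.
  have wl : w l = k by nia.
  have rest : (\sum_(l' | l' != l) w l' * mon l' = 0)%N by nia.
  have em : mon = U_(l)%MM.
    apply/mnmP => l'; rewrite mnm1E; have [<-|nl] := eqVneq l l'; first by rewrite ml1.
    apply/eqP; move/eqP: rest; rewrite sum_nat_eq0 => /forallP/(_ l').
    rewrite eq_sym nl muln_eq0 => /orP[/eqP w0|//]; rewrite eqn0Ngt; apply/negP => h0.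
    by have := none l'; rewrite h0 w0 k0.
  rewrite (bigD1 l) //= ml1 expr1 big1 ?mulr1 => [|l' nl]; last first.
    by rewrite em mnm1E eq_sym (negbTE nl).
  rewrite [RHS](bigD1 l) ?wl ?eqxx //= em eqxx mul1r big1 ?addr0 // => l' /andP[_ nl].
  case: eqP => [/(congr1 (fun q : 'X_{1..n} => q l'))|]; last by rewrite mul0r.
  by rewrite !mnm1E eqxx eq_sym (negbTE nl).
rewrite coef_sum; under eq_bigr => mon _ do rewrite coefZ coefXn -mulrA monE mulr_sumr.
rewrite exchange_big; apply: eq_bigr => l _ /=.
have [hl|hl] := boolP (U_(l)%MM \in msupp f).
  rewrite (bigD1_seq _ hl) ?msupp_uniq //= eqxx mul1r big1 ?addr0 // => mon nm.
  by rewrite (negbTE nm) mul0r mulr0.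
rewrite memN_msupp_eq0 // mul0r big1_seq // => mon /andP[_ hm].
by case: eqP => [em|]; rewrite ?mul0r ?mulr0 //; rewrite -em hm in hl.
Qed.

Lemma rev_roots_poly_scale (K : comNzRingType) (I : Type) (r : seq I) (P : pred I)
    (u : I -> K) (t : K) (j : nat) :
  (rev_roots_poly r P (fun i => t * u i))`_j = t ^+ j * (rev_roots_poly r P u)`_j.
Proof.
rewrite /rev_roots_poly; elim: r j => [|i r IH] j.
  by rewrite !big_nil coef1; case: j => [|j]; rewrite ?expr0 ?mul1r ?mulr0.
rewrite !big_cons; case: (P i); last exact: IH.
rewrite !mulrBl !mul1r !coefB -!mulrA !coefCM !coefXM !IH.
by case: j => [|j] /=; rewrite ?exprS; ring.
Qed.

Section Param.
Variables (K : closedFieldType) (charK : [pchar K] =i pred0).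
Variables (d : nat) (d_gt0 : (0 < d)%N) (zeta : K) (zeta_prim : d.-primitive_root zeta).
Variables (m : nat) (tau : 'I_m -> necklace d).
Variables (S : necklace d -> {set 'I_d}) (S_rep : forall nu, represents (S nu) nu).
Implicit Types (x : 'rV[K]_m) (nu : necklace d).

Local Notation h := (@stab_order d).
Local Notation lambda nu k := (fourier zeta (S nu) k).

Definition root_indices : {set 'I_m * 'I_d} := [set p | p.2 \in S (tau p.1)].
Local Notation R := #|root_indices|.

Definition param_root x (p : 'I_m * 'I_d) : K := zeta ^+ p.2 * x 0 p.1.

Definition param_poly x : {poly K} :=
  \prod_(p in root_indices) ('X - (param_root x p)%:P).

Definition param_coefs x (l : 'I_R) : K := (param_poly x)`_l.

Lemma card_root_indices : R = (\sum_(i < m) weight (tau i))%N.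
Proof.
under [RHS]eq_bigr => i _ do rewrite (weightE (S_rep (tau i))) -sum1_card.
rewrite -sum1_card pair_big_dep /=.
by apply: eq_bigl => p; rewrite inE.
Qed.

Lemma param_poly_monic x : param_poly x \is monic.
Proof. by apply: monic_prod => p _; apply: monicXsubC. Qed.

Lemma size_param_poly x : size (param_poly x) = R.+1.
Proof. by rewrite /param_poly -big_filter size_prod_XsubC size_filter count_index_enum. Qed.

Definition param_matrix : 'M[K]_(m, R) :=
  \matrix_(i < m, l < R) (((enum_val l).1 == i)%:R * zeta ^+ (enum_val l).2).

Lemma param_matrixE x (l : 'I_R) : (x *m param_matrix) 0 l = param_root x (enum_val l).
Proof.
rewrite mxE (bigD1 (enum_val l).1) //= mxE eqxx mul1r big1 => [|i ni].
  by rewrite addr0 mulrC.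
by rewrite mxE eq_sym (negbTE ni) mul0r mulr0.
Qed.

Lemma param_polyE x : param_poly x = linear_roots_poly param_matrix x.
Proof.
rewrite /param_poly big_enum_val; apply: eq_bigr => l _.
by rewrite param_matrixE.
Qed.

Lemma param_poly_closed (c : {poly K}) :
  c \is monic -> size c = R.+1 ->
  (exists x, param_poly x = c) \/
  exists2 f : {mpoly K[R]}, f.@[fun i => c`_i] != 0 & forall x, f.@[param_coefs x] = 0.
Proof.
move=> mc sc; have [[x <-]|[f fc fx]] := linear_roots_poly_closed param_matrix mc sc.
  by left; exists x; rewrite param_polyE.
by right; exists f => // x; rewrite -(fx x) -param_polyE.
Qed.

Lemma polyfun_param_coefs :
  polyfun_coefs (fun x : 'rV[K]_m => x 0) param_poly.
Proof.
apply: polyfun_coefs_prod => p _; apply: polyfun_coefs_XsubC.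
exact: polyfunZ (polyfunX _ p.1).
Qed.

Definition rev_coef x (j : nat) : K :=
  (rev_roots_poly (index_enum _) (mem root_indices) (param_root x))`_j.

Definition psum x (j : nat) : K :=
  power_sum (index_enum _) (mem root_indices) (param_root x) j.

Lemma param_poly_coef x j : (j <= R)%N -> (param_poly x)`_(R - j) = rev_coef x j.
Proof.
have := @rev_roots_polyE K _ (index_enum ('I_m * 'I_d)%type)
  (mem root_indices) (param_root x) j.
by rewrite count_index_enum.
Qed.

Lemma rev_coef_gt x j : (R < j)%N -> rev_coef x j = 0.
Proof.
move=> hj; apply: nth_default; apply: leq_trans (size_rev_roots_poly _ _ _) _.
by rewrite count_index_enum.
Qed.

Lemma rev_coef0 x : rev_coef x 0 = 1.
Proof. exact: rev_roots_poly0. Qed.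

Lemma psumE x j : psum x j = \sum_(i < m) lambda (tau i) j * x 0 i ^+ j.
Proof.
rewrite /psum /power_sum; under [RHS]eq_bigr => i _ do rewrite mulr_suml.
rewrite pair_big_dep; apply: eq_big => [p|p _]; first by rewrite /= inE /=.
by rewrite exprMn -exprM.
Qed.

Lemma polyfun_rev_coef j : polyfun param_coefs (fun x => rev_coef x j).
Proof.
have [->|j0] := posnP j.
  by apply: polyfun_ext (polyfunC _ 1) => x; rewrite rev_coef0.
have [hj|hj] := leqP j R; last first.
  by apply: polyfun_ext (polyfunC _ 0) => x; rewrite rev_coef_gt.
have hl : (R - j < R)%N by lia.
apply: polyfun_ext (polyfunX _ (Ordinal hl)) => x.
by rewrite /param_coefs /= param_poly_coef.
Qed.

Lemma polyfun_psum j : (0 < j)%N -> polyfun param_coefs (fun x => psum x j).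
Proof. by move=> j0; apply: polyfun_power_sum => // i _; apply: polyfun_rev_coef. Qed.

Definition fiber nu : {set 'I_m} := [set i | tau i == nu].

Definition block_power x nu (i : 'I_m) : K := x 0 i ^+ h nu.

Definition block_coef x nu (j : nat) : K :=
  (rev_roots_poly (index_enum _) (mem (fiber nu)) (block_power x nu))`_j.

Definition block_psum x nu (j : nat) : K :=
  power_sum (index_enum _) (mem (fiber nu)) (block_power x nu) j.

Lemma block_coef0 x nu : block_coef x nu 0 = 1.
Proof. exact: rev_roots_poly0. Qed.

Lemma block_coef_gt x nu j : (#|fiber nu| < j)%N -> block_coef x nu j = 0.
Proof.
move=> hj; apply: nth_default; apply: leq_trans (size_rev_roots_poly _ _ _) _.
by rewrite count_index_enum.
Qed.

Lemma block_poly_coef x nu j : (j <= #|fiber nu|)%N ->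
  (\prod_(i in fiber nu) ('X - (block_power x nu i)%:P))`_(#|fiber nu| - j) =
    block_coef x nu j.
Proof.
have := @rev_roots_polyE K _ (index_enum 'I_m) (mem (fiber nu)) (block_power x nu) j.
by rewrite count_index_enum.
Qed.

(** When [h nu] does not divide [j] the truncated quotient has no meaning, but the Fourier
    coefficient in front of it is 0. *)
Lemma psum_blocks x j :
  psum x j = \sum_nu lambda nu j * block_psum x nu (j %/ h nu).
Proof.
rewrite psumE (partition_big tau xpredT) //=; apply: eq_bigr => nu _.
rewrite /block_psum /power_sum mulr_sumr.
apply: eq_big => [i|i /eqP ->]; first by rewrite /= inE.
have [hj|hj] := boolP (h nu %| j)%N; last first.
  by rewrite (fourier_eq0 d_gt0 zeta_prim (S_rep nu) hj) !mul0r.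
by rewrite /block_power -exprM mulnC divnK.
Qed.

Lemma block_index nu j : (j < #|fiber nu|)%N ->
  exists2 i, tau i = nu & index i (enum (fiber (tau i))) = j.
Proof.
move=> hj; exists (enum_val (Ordinal hj)).
  by have := enum_valP (Ordinal hj); rewrite inE => /eqP.
have := enum_valP (Ordinal hj); rewrite inE => /eqP ->.
by rewrite (enum_val_nth (enum_val (Ordinal hj))) index_uniq ?enum_uniq // -cardE.
Qed.

Lemma block_index_lt i : (index i (enum (fiber (tau i))) < #|fiber (tau i)|)%N.
Proof. by rewrite cardE index_mem mem_enum inE. Qed.

(** The rank of [i] in its fiber, plus one, serves as a degree: each fiber of cardinality [n] thus
    contributes its coefficients of index [1, ..., n], and there are [m] coordinates in all. *)
Definition block_coords x (i : 'I_m) : K :=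
  block_coef x (tau i) (index i (enum (fiber (tau i)))).+1.

Lemma polyfun_block_coords nu j : polyfun block_coords (fun x => block_coef x nu j).
Proof.
case: j => [|j]; first by apply: polyfun_ext (polyfunC _ 1) => x; rewrite block_coef0.
have [hj|hj] := ltnP j #|fiber nu|; last first.
  by apply: polyfun_ext (polyfunC _ 0) => x; rewrite block_coef_gt.
have [i ti ri] := block_index hj.
by apply: polyfun_ext (polyfunX _ i) => x; rewrite /block_coords ri ti.
Qed.

Lemma polyfun_param_coefs_blocks (l : 'I_R) :
  polyfun block_coords (fun x => param_coefs x l).
Proof.
apply: (@polyfun_ext _ _ _ _ (fun x => rev_coef x (R - l))).
  move=> x; have := ltn_ord l => hl.
  by rewrite -param_poly_coef ?leq_subr // subKn // ltnW.
apply: polyfun_rev_roots => // i /andP[i0 _].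
apply: polyfun_ext (fun x => esym (psum_blocks x i)) _.
apply: polyfun_sum => nu _; have [hi|hi] := boolP (h nu %| i)%N; last first.
  apply: polyfun_ext (polyfunC _ 0) => x.
  by rewrite (fourier_eq0 d_gt0 zeta_prim (S_rep nu) hi) mul0r.
apply: polyfunZ; apply: polyfun_power_sum => [|j _]; last exact: polyfun_block_coords.
by rewrite divn_gt0 ?(stab_order_gt0 d_gt0) // dvdn_leq.
Qed.

(** Algebraic closedness enters twice: for each type the monic polynomial with the prescribed
    coefficients is split, and then an [h nu]-th root of each of its roots is taken. *)
Lemma block_coords_surj (z : 'rV[K]_m) : exists x, forall i, block_coords x i = z 0 i.
Proof.
pose idx nu i := index i (enum (fiber nu)).
have hw nu : exists w : nat -> K, forall i, tau i = nu ->
    (\prod_(l < #|fiber nu|) ('X - (w l)%:P))`_(#|fiber nu| - (idx nu i).+1) = z 0 i.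
  set n := #|fiber nu|.
  (* Ranks in a fiber are distinct, so the inner sum only selects the prescribed value belonging to
     degree [l]. *)
  pose tail : {poly K} :=
    \poly_(l < n) (\sum_(i | (tau i == nu) && (n - (idx nu i).+1 == l)%N) z 0 i).
  have lt_tail : (size tail < size ('X^n : {poly K})%R)%N.
    by rewrite size_polyXn ltnS size_poly.
  have mq : 'X^n + tail \is monic by rewrite monicE lead_coefDl // lead_coefXn.
  have szq : size ('X^n + tail) = n.+1 by rewrite size_polyDl // size_polyXn.
  have [w ew] := monic_roots_poly mq szq.
  pose w' (l : nat) : K := if (insub l : option 'I_n) is Some l' then w l' else 0.
  exists w' => i ti.
  have hi : (idx nu i < n)%N by have := block_index_lt i; rewrite ti.
  transitivity (('X^n + tail)`_(n - (idx nu i).+1)).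
    rewrite ew; congr ((polyseq _)`__).
    by apply: (@eq_roots_poly _ _ (fun l : 'I_n => w' l) w) => l; rewrite /w' valK.
  rewrite coefD coefXn coef_poly; have -> : (n - (idx nu i).+1 < n)%N by lia.
  have -> : (n - (idx nu i).+1 == n)%N = false by lia.
  rewrite add0r (bigD1 i) ?ti ?eqxx //= big1 ?addr0 // => i' /andP[/andP[/eqP ti' /eqP e] ni].
  have hi' : (idx nu i' < n)%N by have := block_index_lt i'; rewrite ti'.
  have sub_inj a b : (n - a.+1 = n - b.+1 -> a < n -> b < n -> a = b)%N by lia.
  have := sub_inj _ _ e hi' hi.
  move/(congr1 (nth i (enum (fiber nu)))).
  rewrite !nth_index ?mem_enum ?inE ?ti ?ti' // => ei.
  by rewrite ei eqxx in ni.
have [w hw'] := fin_all_exists hw.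
have hx i : exists y : K, y ^+ h (tau i) = w (tau i) (index i (enum (fiber (tau i)))).
  exact/closed_root/stab_order_gt0.
have [y hy] := fin_all_exists hx; exists (\row_i y i) => i.
rewrite /block_coords -block_poly_coef ?block_index_lt // -(hw' (tau i) i) //.
congr ((polyseq _)`__); rewrite big_enum_val; apply: eq_bigr => l _.
have := enum_valP l; rewrite inE => /eqP tl.
rewrite /block_power mxE; have := hy (enum_val l); rewrite tl => ->; congr ('X - (w _ _)%:P).
by rewrite (enum_val_nth (enum_val l)) index_uniq ?enum_uniq // -cardE.
Qed.

(** * Sufficiency of the two conditions *)

Section Sufficiency.
Hypothesis disjoint_fibers : forall nu nu' j j', nu <> nu' ->
  (0 < j <= #|fiber nu|)%N -> (0 < j' <= #|fiber nu'|)%N -> (h nu * j <> h nu' * j')%N.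
Hypothesis lambda_neq0 : forall nu j, (0 < j <= #|fiber nu|)%N -> lambda nu (h nu * j) != 0.

(** The induction is on the weight [k = h nu * j], over all types at once. If [h nu'] divides [k]
    for another type, disjointness puts [k / h nu'] beyond the size of its fiber, so its power sum
    involves only coefficients of weight below [k]. Thus [psum x k] contains a single unknown, the
    block sum of [nu], with the invertible factor [lambda nu k]. *)
Lemma polyfun_block_coef nu j : polyfun param_coefs (fun x => block_coef x nu j).
Proof.
move: {2}(h nu * j)%N (erefl (h nu * j)%N) => k.
elim/ltn_ind: k nu j => k IH nu j ek.
have [->|j0] := posnP j.
  by apply: polyfun_ext (polyfunC _ 1) => x; rewrite block_coef0.
have [hj|hj] := leqP j #|fiber nu|; last first.
  by apply: polyfun_ext (polyfunC _ 0) => x; rewrite block_coef_gt.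
have hnu := stab_order_gt0 d_gt0.
have k0 : (0 < k)%N by rewrite -ek muln_gt0 hnu.
have IHlt nu' i : (h nu' * i < k)%N -> polyfun param_coefs (fun x => block_coef x nu' i).
  by move=> /IH; apply.
have l0 : lambda nu k != 0 by rewrite -ek lambda_neq0 // j0.
pose others x := \sum_(nu' | nu' != nu) lambda nu' k * block_psum x nu' (k %/ h nu').
have ho : polyfun param_coefs others.
  apply: polyfun_sum => nu' /eqP nn; have [hk|hk] := boolP (h nu' %| k)%N; last first.
    apply: polyfun_ext (polyfunC _ 0) => x.
    by rewrite (fourier_eq0 d_gt0 zeta_prim (S_rep nu') hk) mul0r.
  set j' := (k %/ h nu')%N; have ek' : (h nu' * j' = k)%N by rewrite mulnC divnK.
  have j'0 : (0 < j')%N by move: k0; rewrite -ek' muln_gt0 => /andP[].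
  have lt_j' : (#|fiber nu'| < j')%N.
    rewrite ltnNge; apply/negP => le_j'; apply: (disjoint_fibers nn (j := j') (j' := j)).
    - by rewrite j'0.
    - by rewrite j0.
    by rewrite ek' ek.
  apply: polyfunZ; apply: polyfun_power_sum => // i.
  rewrite leq_eqVlt => /orP[/eqP ->|lt_i].
    by apply: polyfun_ext (polyfunC _ 0) => x; apply/esym/block_coef_gt.
  by apply: IHlt; rewrite -ek' ltn_pmul2l.
have hs : polyfun param_coefs (fun x => block_psum x nu j + block_coef x nu j *+ j).
  by apply: polyfun_newton_step => // i hi; apply: IHlt; rewrite -ek ltn_pmul2l.
have hp := polyfunZ (lambda nu k)^-1 (polyfunB (polyfun_psum k0) ho).
apply: polyfun_ext (polyfunZ j%:R^-1 (polyfunB hs hp)) => x.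
rewrite psum_blocks (bigD1 nu) //= -/(others x) addrK mulKf //.
rewrite -[in (k %/ _)%N]ek mulKn // [X in X - _]addrC addrK.
by rewrite -[X in _ * X]mulr_natl mulKf // natr_neq0.
Qed.

Lemma param_image_iso (Y : 'rV[K]_R -> Prop) :
  (forall y, Y y <-> exists x, y = \row_l param_coefs x l) ->
  isomorphic_varieties Y (@affine_space K m).
Proof.
move=> Yimg.
have [f hf] : exists f : 'I_m -> {mpoly K[R]},
    forall x i, block_coords x i = (f i).@[param_coefs x].
  by apply: polyfun_tuple => i; apply: polyfun_block_coef.
have [g hg] : exists g : 'I_R -> {mpoly K[m]},
    forall x l, param_coefs x l = (g l).@[block_coords x].
  exact: polyfun_tuple polyfun_param_coefs_blocks.
have fE x : poly_map f (\row_l param_coefs x l) = \row_i block_coords x i.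
  apply/rowP => i; rewrite !mxE hf; apply: meval_eq => l; by rewrite mxE.
have gE x : poly_map g (\row_i block_coords x i) = \row_l param_coefs x l.
  apply/rowP => i; rewrite !mxE hg; apply: meval_eq => l; by rewrite mxE.
have surj z : exists x, z = \row_i block_coords x i.
  by have [x hx] := block_coords_surj z; exists x; apply/rowP => i; rewrite mxE hx.
exists f, g; split=> //.
- by move=> z _; have [x ->] := surj z; apply/Yimg; exists x; rewrite gE.
- by move=> y /Yimg [x ->]; rewrite fE gE.
by move=> z _; have [x ->] := surj z; rewrite gE fE.
Qed.

End Sufficiency.

(** * Generic fibers of the parametrization, and integrality *)

Definition separated x : bool :=
  [forall i, x 0 i != 0] && [forall i, forall j, (x 0 i ^+ d == x 0 j ^+ d) ==> (i == j)].

Lemma separatedP x :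
  reflect ((forall i, x 0 i != 0) /\ injective (fun i => x 0 i ^+ d)) (separated x).
Proof.
apply: (iffP andP) => [[/forallP x0 /forallP xd]|[x0 xd]]; split=> //.
- by move=> i j /= e; have /forallP/(_ j)/implyP/(_ _)/eqP := xd i; apply; apply/eqP.
- exact/forallP.
by apply/forallP => i; apply/forallP => j; apply/implyP => /eqP /xd ->.
Qed.

Definition discriminant x : K :=
  (\prod_i x 0 i) * \prod_(p : 'I_m * 'I_m | p.1 != p.2) (x 0 p.1 ^+ d - x 0 p.2 ^+ d).

Lemma discriminant_neq0 x : (discriminant x != 0) = separated x.
Proof.
rewrite mulf_eq0 negb_or; apply/andP/separatedP => [[/prodf_neq0 x0 /prodf_neq0 xd]|[x0 xd]].
  split=> [i|i j /= e]; first exact: x0.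
  by apply/eqP/negPn/negP => nij; have := xd (i, j) nij; rewrite /= e subrr eqxx.
split; first by apply/prodf_neq0 => i _.
apply/prodf_neq0 => -[i j] /= nij.
by rewrite subr_eq0; apply: contra nij => /eqP /xd ->.
Qed.

Lemma polyfun_discriminant : polyfun (fun x : 'rV[K]_m => x 0) discriminant.
Proof.
apply: polyfunM; first by apply: polyfun_prod => i _; apply: polyfunX.
apply: polyfun_prod => p _.
by apply: polyfunB; apply: polyfun_exp; apply: polyfunX.
Qed.

Lemma separated_exists : exists x, separated x.
Proof.
exists (\row_i i.+1%:R); apply/separatedP; split=> [i|i j] /=.
  by rewrite mxE natr_neq0.
rewrite !mxE -!natrX => /eqP e; apply/val_inj/eqP; rewrite -eqSS -(eqn_exp2r _ _ d_gt0).
have natr_le (a b : nat) : (a <= b)%N -> a%:R == b%:R :> K -> a = b.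
  move=> leab; rewrite eq_sym -subr_eq0 -natrB // ((pcharf0P K).1 charK) subn_eq0 => leba.
  by apply/eqP; rewrite eqn_leq leab.
case/orP: (leq_total (i.+1 ^ d) (j.+1 ^ d)) => /natr_le; first by move/(_ e) ->.
by rewrite eq_sym in e; move/(_ e) ->.
Qed.

Lemma root_param_poly x y : reflect (exists i b, b \in S (tau i) /\ y = zeta ^+ b * x 0 i)
  (root (param_poly x) y).
Proof.
rewrite /root /param_poly horner_prod.
apply: (iffP idP) => [|[i [b [hb ->]]]].
  move/prodf_eq0 => [[i b]]; rewrite inE /= hornerXsubC subr_eq0 => hb /eqP ->.
  by exists i, b.
by apply/prodf_eq0; exists (i, b); rewrite ?inE //= hornerXsubC subrr.
Qed.

Lemma root_param_poly_block x i n : separated x ->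
  root (param_poly x) (zeta ^+ n * x 0 i) = mem_mod (S (tau i)) n.
Proof.
move=> /separatedP [x0 xd]; rewrite -(mem_mod_modn _ n).
apply/root_param_poly/idP => [[j [b [hb e]]]|hn].
  have ei : i = j.
    apply: xd; rewrite /=; have := congr1 (fun u => u ^+ d) e.
    rewrite !exprMn -!exprM ![(_ * d)%N]mulnC !exprM.
    by rewrite (prim_expr_order zeta_prim) !expr1n !mul1r.
  rewrite -ei in hb e; move/(mulIf (x0 i))/eqP: e.
  rewrite (eq_prim_root_expr zeta_prim) => /eqP ->.
  by rewrite modn_small // mem_mod_ord.
exists i, (Ordinal (ltn_pmod n d_gt0)); split; first by rewrite -mem_mod_ord.
by rewrite /= (prim_expr_mod zeta_prim).
Qed.

(** The form in which dominance is used: no coordinate [x_i] is invisible in the roots of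
    [param_poly x]. *)
Hypothesis S_neq0 : forall i, (0 < #|S (tau i)|)%N.

(** Matching roots gives [x'_i = zeta^c x_(p i)], and comparing [d]-th powers in both directions
    makes [p] a permutation. Reading the roots of one block in both parametrizations shows that
    matched blocks carry subsets that are rotations of each other, hence the same necklace. The
    rotation then stabilizes the chosen subset, so its root of unity disappears in the [h nu]-th
    power. *)
Lemma block_psum_generic x x' nu j : separated x -> param_poly x' = param_poly x ->
  block_psum x' nu j = block_psum x nu j.
Proof.
move=> sx ex; have /separatedP [x0 xd] := sx.
have zd n : (zeta ^+ n) ^+ d = 1.
  by rewrite -exprM mulnC exprM (prim_expr_order zeta_prim) expr1n.
have z0 n : zeta ^+ n != 0 by rewrite expf_neq0 // (zeta_neq0 d_gt0 zeta_prim).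
have [p hp] : exists p : 'I_m -> 'I_m * 'I_d, forall i, x' 0 i = zeta ^+ (p i).2 * x 0 (p i).1.
  apply: (@fin_all_exists _ (fun=> ('I_m * 'I_d)%type)
    (fun i q => x' 0 i = zeta ^+ q.2 * x 0 q.1)) => i.
  have /card_gt0P [b hb] := S_neq0 i.
  have : root (param_poly x) (zeta ^+ b * x' 0 i).
    by rewrite -ex; apply/root_param_poly; exists i, b.
  case/root_param_poly => l [c [_ e]].
  (* [d - b] stands for [-b] modulo [d], so that the second component represents [c - b]. *)
  exists (l, Ordinal (ltn_pmod (c + (d - b)) d_gt0)).
  rewrite /= (prim_expr_mod zeta_prim) exprD; apply: (mulfI (z0 b)).
  by rewrite e mulrA mulrCA -exprD subnKC 1?ltnW // (prim_expr_order zeta_prim) mulr1.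
have x'd i : x' 0 i ^+ d = x 0 (p i).1 ^+ d by rewrite hp exprMn zd mul1r.
have [s hs] : exists s : 'I_m -> 'I_m, forall i, (p (s i)).1 = i.
  apply: (@fin_all_exists _ (fun=> 'I_m) (fun i l => (p l).1 = i)) => i.
  have /card_gt0P [b hb] := S_neq0 i.
  have : root (param_poly x') (zeta ^+ b * x 0 i).
    by rewrite ex; apply/root_param_poly; exists i, b.
  case/root_param_poly => l [c [_ e]]; exists l; apply: xd; rewrite /= -x'd.
  by have := congr1 (fun u => u ^+ d) e; rewrite !exprMn !zd !mul1r.
have s_inj : injective s := (can_inj (g := fun i => (p i).1) hs).
have sK : cancel (fun i => (p i).1) s.
  by move=> i; have [t _ ht] := injF_bij s_inj; rewrite -[i]ht hs.
have sx' : separated x'.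
  apply/separatedP; split=> [i|i l /=]; first by rewrite hp mulf_neq0.
  by rewrite !x'd => /xd /(can_inj sK).
have shift i n : mem_mod (S (tau i)) (n + (p (s i)).2) = mem_mod (S (tau (s i))) n.
  rewrite -(root_param_poly_block i _ sx) -(root_param_poly_block (s i) _ sx') ex.
  by rewrite hp hs mulrA -exprD.
have ts i : tau (s i) = tau i.
  by apply/esym; apply: (necklace_shift d_gt0 (S_rep _) (S_rep _) (shift i)).
rewrite /block_psum /power_sum [LHS](reindex_inj s_inj) /=.
apply: eq_big => [i|i]; first by rewrite !inE ts.
rewrite !inE ts => /eqP ti; rewrite /block_power hp hs !exprMn.
have /(stab_order_expr d_gt0 zeta_prim (S_rep nu)) : shift_stab (S nu) (p (s i)).2.
  by apply/(shift_stabP d_gt0) => n; rewrite -ti shift ts.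
by move=> e; rewrite -(exprM zeta) e expr1n mul1r.
Qed.

Lemma param_coordinate i : exists b, forall x, x 0 i = b.2 * (x *m param_matrix) 0 b.1.
Proof.
have /card_gt0P [b hb] := S_neq0 i.
have hib : (i, b) \in root_indices by rewrite inE.
exists (enum_rank_in hib (i, b), (zeta ^+ b)^-1) => x.
rewrite param_matrixE enum_rankK_in // /param_root mulKf //.
by rewrite expf_neq0 // (zeta_neq0 d_gt0 zeta_prim).
Qed.

Lemma block_psumE x nu j : block_psum x nu j = \sum_(i in fiber nu) (x 0 i ^+ h nu) ^+ j.
Proof. by []. Qed.

Lemma block_psum_fraction nu j : exists f1 f2 : {mpoly K[R]},
  (forall x, block_psum x nu j * f2.@[param_coefs x] = f1.@[param_coefs x]) /\
  exists x, f2.@[param_coefs x] != 0.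
Proof.
have [b hb] := fin_all_exists param_coordinate.
pose Q : {mpoly K[R]} := \sum_(i in fiber nu) (((b i).2 *: 'X_(b i).1) ^+ h nu) ^+ j.
have hQ x : Q.@[(x *m param_matrix) 0] = block_psum x nu j.
  rewrite block_psumE meval_sum; apply: eq_bigr => i _.
  by rewrite !mevalXn mevalZ mevalXU -hb.
have D0 : exists x, discriminant x != 0.
  by have [x hx] := separated_exists; exists x; rewrite discriminant_neq0.
have [x x'|f1 [f2 [e ne]]] := linear_roots_poly_invariant charK (Q := Q)
    (M := param_matrix) polyfun_discriminant D0.
  by rewrite discriminant_neq0 -!param_polyE !hQ => sx /(block_psum_generic nu j sx).
have coefsE (f : {mpoly K[R]}) x :
    f.@[param_coefs x] = f.@[fun i => (linear_roots_poly param_matrix x)`_i].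
  by apply: meval_eq => i; rewrite -param_polyE.
exists f1, f2; split=> [x|]; first by rewrite !coefsE -hQ.
by have [x hx] := ne; exists x; rewrite coefsE.
Qed.

(** For [b] in [S (tau i)], the element [zeta ^+ b * x_i] is a root of the monic [param_poly x],
    whose lower coefficients are the [F l]; the constant [zeta ^+ b] is then divided out. *)
Lemma coordinate_integral (F : 'I_R -> {mpoly K[m]}) i :
  (forall x l, param_coefs x l = (F l).@[x 0]) ->
  integralOver (comp_mpoly [tuple F l | l < R]) ('X_i : {mpoly K[m]}).
Proof.
move=> hF; have /card_gt0P [b hb] := S_neq0 i.
have z0 : zeta ^+ b != 0 by rewrite expf_neq0 // (zeta_neq0 d_gt0 zeta_prim).
have intC (c : K) : integralOver (comp_mpoly [tuple F l | l < R]) (c%:MP : {mpoly K[m]}).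
  by rewrite -(comp_mpolyC c [tuple F l | l < R]); apply: integral_id.
suff intb : integralOver (comp_mpoly [tuple F l | l < R])
    ((zeta ^+ b)%:MP * 'X_i : {mpoly K[m]}).
  have -> : 'X_i = ((zeta ^+ b)^-1)%:MP * ((zeta ^+ b)%:MP * 'X_i) :> {mpoly K[m]}.
    by rewrite mulrA -mpolyCM mulVf // mpolyC1 mul1r.
  exact: integral_mul.
pose p : {poly {mpoly K[R]}} := 'X^R + \sum_(l < R) ('X_l)%:P * 'X^l.
have sp : (size (\sum_(l < R) ('X_l)%:P * 'X^l : {poly {mpoly K[R]}})%R <= R)%N.
  apply: leq_trans (size_sum _ _ _) _; apply/bigmax_leqP => l _.
  rewrite mul_polyC; apply: leq_trans (size_scale_leq _ _) _.
  by rewrite size_polyXn.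
exists p; first by rewrite monicE lead_coefDl ?lead_coefXn // size_polyXn ltnS.
apply/rootP; apply: mpoly_eq_points => x; rewrite meval0.
rewrite /p rmorphD /= rmorph_sum /= map_polyXn hornerD hornerXn horner_sum.
rewrite mevalD mevalXn mevalM mevalC mevalXU.
have : root (param_poly x) (zeta ^+ b * x 0 i) by apply/root_param_poly; exists i, b.
move/rootP; rewrite horner_coef size_param_poly big_ord_recr /= addrC.
have /monicP := param_poly_monic x.
rewrite /lead_coef size_param_poly /= => ->; rewrite mul1r => e.
rewrite -[RHS]e; congr (_ + _).
rewrite meval_sum; apply: eq_bigr => l _ /=.
rewrite rmorphM /= map_polyC map_polyXn /= comp_mpolyXU -tnth_nth tnth_mktuple.
by rewrite hornerM hornerC hornerXn mevalM -hF mevalXn mevalM mevalC mevalXU.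
Qed.

Lemma normal_polyfun_block_psum (Y : 'rV[K]_R -> Prop) nu j :
  (forall y, Y y <-> exists x, y = \row_l param_coefs x l) -> normal_variety Y ->
  polyfun param_coefs (fun x => block_psum x nu j).
Proof.
move=> Yimg Ynorm.
have [F hF] : exists F : 'I_R -> {mpoly K[m]}, forall x l, param_coefs x l = (F l).@[x 0].
  apply: polyfun_tuple => l; exact: (polyfun_param_coefs l).
have FE x : poly_map F x = \row_l param_coefs x l.
  by apply/rowP => l; rewrite !mxE hF.
have compE (f : {mpoly K[R]}) x : (f \mPo [tuple F l | l < R]).@[x 0] = f.@[param_coefs x].
  by rewrite comp_mpoly_meval_row FE; apply: meval_eq => l; rewrite mxE.
pose q : {mpoly K[m]} := \sum_(i in fiber nu) ('X_i ^+ h nu) ^+ j.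
have hq x : q.@[x 0] = block_psum x nu j.
  rewrite block_psumE meval_sum; apply: eq_bigr => i _.
  by rewrite !mevalXn mevalXU.
have [f1 [f2 [e [x0 ne]]]] := block_psum_fraction nu j.
have [f hf] : exists f, q = f \mPo [tuple F l | l < R].
  apply: (normal_image_polyfun (Y := Y) (f1 := f1) (f2 := f2)) => //.
  - move=> y; rewrite Yimg; split=> -[x ->]; exists x; by rewrite FE.
  - have intX (u : {mpoly K[m]}) k : integralOver (comp_mpoly [tuple F l | l < R]) u ->
        integralOver (comp_mpoly [tuple F l | l < R]) (u ^+ k).
      move=> hu; elim: k => [|k IH]; first exact: integral1.
      by rewrite exprS; apply: integral_mul.
    apply: big_ind => [||i _]; [exact: integral0|exact: integral_add|].
    exact: intX _ _ (intX _ _ (coordinate_integral i hF)).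
  - by apply: mpoly_eq_points => x; rewrite mevalM !compE hq e.
  by apply: contra ne => /eqP e0; rewrite -compE e0 meval0.
by exists f => x; rewrite -hq hf compE.
Qed.

(** * Scaling weights and necessity of the two conditions *)

Lemma param_coefs_rev x (l : 'I_R) : param_coefs x l = rev_coef x (R - l).
Proof. by rewrite -param_poly_coef ?leq_subr // subKn // ltnW. Qed.

Lemma param_coefs_scale t x (l : 'I_R) :
  param_coefs (t *: x) l = t ^+ (R - l) * param_coefs x l.
Proof.
rewrite !param_coefs_rev /rev_coef -rev_roots_poly_scale; congr ((polyseq _)`__).
by apply: eq_bigr => p _; rewrite /param_root mxE mulrCA.
Qed.

Lemma block_psum_scale t x nu j :
  block_psum (t *: x) nu j = t ^+ (h nu * j) * block_psum x nu j.
Proof.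
rewrite !block_psumE mulr_sumr; apply: eq_bigr => i _.
by rewrite mxE !exprMn -!exprM.
Qed.

Lemma rev_coef_eq0 x k : (forall i, (0 < i < k)%N -> psum x i = 0) ->
  forall i, (0 < i < k)%N -> rev_coef x i = 0.
Proof.
move=> hp i; case/andP=> i0 ik.
have := newton_identity (index_enum _) (mem root_indices) (param_root x) i.
rewrite big1 ?addr0 => [|a _]; last first.
  by rewrite [power_sum _ _ _ _]hp ?mulr0 // subn_gt0 ltn_ord (leq_ltn_trans (leq_subr _ _)).
move/eqP; rewrite -mulr_natl mulf_eq0 (negbTE (natr_neq0 charK i0)) /=.
by move/eqP.
Qed.

Lemma rev_coef_lead x k : (0 < k)%N -> (forall i, (0 < i < k)%N -> psum x i = 0) ->
  k%:R * rev_coef x k = - psum x k.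
Proof.
case: k => // k _ hp.
have := newton_identity (index_enum _) (mem root_indices) (param_root x) k.+1.
rewrite big_ord_recl big1 => [|a _]; last first.
  rewrite [power_sum _ _ _ _]hp ?mulr0 // subn_gt0 ltnS ltn_ord.
  by rewrite /bump /= subSS ltnS leq_subr.
rewrite addr0 rev_roots_poly0 mul1r subn0 => /eqP.
by rewrite addr_eq0 mulr_natl => /eqP.
Qed.

(** Vanishing lower power sums annihilate the coefficients of weight below [k], so only the linear
    part of [f] in weight [k] remains. There the coefficient of [param_poly x] is [- psum x k / k]
    by Newton. The order of quantifiers matters: [A] does not depend on [x]. *)
Lemma block_psum_linear nu j : (0 < j)%N ->
  polyfun param_coefs (fun x => block_psum x nu j) ->
  exists A : K, forall x, (forall i, (0 < i < h nu * j)%N -> psum x i = 0) ->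
    block_psum x nu j = A * psum x (h nu * j).
Proof.
set k := (h nu * j)%N => j0 [f hf].
have k0 : (0 < k)%N by rewrite muln_gt0 (stab_order_gt0 d_gt0).
(* The sum has at most the term [l = R - k], and is empty when [k > R]. *)
exists (- (\sum_(l < R | (R - l)%N == k) f@_U_(l)) / k%:R) => x hx.
have y0 (l : 'I_R) : (R - l < k)%N -> param_coefs x l = 0.
  by move=> hl; have := ltn_ord l => ?; rewrite param_coefs_rev (rev_coef_eq0 hx) //; lia.
have := weighted_linear_part k0 y0 (f := f) (c := block_psum x nu j).
rewrite -mulrA [_^-1 * _]mulrC -mulN1r -mulrA; move->.
  rewrite mulrCA mulN1r -mulNr -(rev_coef_lead k0 hx) mulrAC divff ?natr_neq0 // mul1r.
  rewrite mulr_suml; apply: eq_bigr => l /eqP hl.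
  by rewrite param_coefs_rev hl.
move=> t; rewrite mulrC -block_psum_scale hf; apply: meval_eq => l.
by rewrite param_coefs_scale.
Qed.

(* The nonzero coordinates of the witness are theta^0, ..., theta^(j-1) with theta
   a primitive root of unity of order h_nu j, so that its power sums of smaller
   positive degree vanish. *)
Lemma block_witness nu j : (0 < j <= #|fiber nu|)%N -> exists x,
  [/\ block_psum x nu j = j%:R,
      forall nu' i, nu' != nu -> (0 < i)%N -> block_psum x nu' i = 0,
      forall i, (0 < i < h nu * j)%N -> psum x i = 0 &
      psum x (h nu * j) = lambda nu (h nu * j) * j%:R].
Proof.
case/andP=> j0 hj; have h0 := stab_order_gt0 d_gt0.
set k := (h nu * j)%N; have k0 : (0 < k)%N by rewrite muln_gt0 h0.
have [theta th] := closed_prim_root charK k0.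
pose idx i := index i (enum (fiber nu)).
pose x : 'rV[K]_m := \row_i (if (tau i == nu) && (idx i < j)%N then theta ^+ idx i else 0).
have x_nu i : (0 < i)%N -> block_psum x nu i = \sum_(a < j) (theta ^+ (h nu * i)) ^+ a.
  move=> i0; rewrite block_psumE big_enum_val.
  rewrite (big_ord_widen _ (fun a => (theta ^+ (h nu * i)) ^+ a) hj) [RHS]big_mkcond /=.
  apply: eq_bigr => l _; have := enum_valP l; rewrite inE => /eqP tl.
  have -> : l = idx (enum_val l) :> nat.
    by rewrite /idx [in index _ _](enum_val_nth (enum_val l)) index_uniq ?enum_uniq // -cardE.
  rewrite mxE tl eqxx /=; case: ifP => _; first by rewrite -!exprM; congr (_ ^+ _); lia.
  by rewrite -exprM expr0n muln_eq0 !eqn0Ngt h0 i0.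
have x_other nu' i : nu' != nu -> (0 < i)%N -> block_psum x nu' i = 0.
  move=> nn i0; rewrite block_psumE big1 // => l; rewrite inE => /eqP tl.
  by rewrite mxE tl (negbTE nn) -exprM expr0n muln_eq0 !eqn0Ngt h0 i0.
have x_psum i : (0 < i)%N -> psum x i = lambda nu i * block_psum x nu (i %/ h nu).
  move=> i0; rewrite (psum_blocks) (bigD1 nu) //= big1 ?addr0 // => nu' nn.
  have [hi|hi] := boolP (h nu' %| i)%N; last first.
    by rewrite (fourier_eq0 d_gt0 zeta_prim (S_rep nu') hi) mul0r.
  by rewrite x_other ?mulr0 // divn_gt0 // dvdn_leq.
have xj : block_psum x nu j = j%:R.
  rewrite x_nu // (prim_expr_order th) -[j in RHS]card_ord -sumr_const.
  by apply: eq_bigr => a _; rewrite expr1n.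
exists x; split=> // [i /andP[i0 ik]|]; last by rewrite x_psum // mulKn // xj.
rewrite x_psum //; have [/dvdnP [i' ei]|hi] := boolP (h nu %| i)%N; last first.
  by rewrite (fourier_eq0 d_gt0 zeta_prim (S_rep nu) hi) mul0r.
have i'0 : (0 < i')%N by move: i0; rewrite ei muln_gt0 => /andP[].
rewrite {2}ei mulnK // x_nu // [(h nu * i')%N]mulnC -ei.
have z1 : theta ^+ i - 1 != 0.
  by rewrite subr_eq0 -(prim_order_dvd th) gtnNdvd.
(* A geometric sum: [theta ^+ i] is not 1 because [0 < i < k], whereas its [j]-th power is 1. *)
suff -> : \sum_(a < j) (theta ^+ i) ^+ a = 0 by rewrite mulr0.
apply: (mulfI z1); rewrite mulr0 -subrX1 -exprM.
have -> : (i * j = k * i')%N by rewrite ei /k; lia.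
by rewrite exprM (prim_expr_order th) expr1n subrr.
Qed.

Hypothesis block_psum_poly : forall nu j, polyfun param_coefs (fun x => block_psum x nu j).

Lemma necessary_lambda nu j : (0 < j <= #|fiber nu|)%N -> lambda nu (h nu * j) != 0.
Proof.
move=> hj; have [x [xj _ x0 xk]] := block_witness hj; have /andP[j0 _] := hj.
have [A hA] := block_psum_linear j0 (block_psum_poly nu j).
have := natr_neq0 charK j0; rewrite -xj (hA x x0) xk.
by apply: contra => /eqP ->; rewrite mul0r mulr0.
Qed.

(** The witness of type [nu] forces the constant [A] to be nonzero. At the witness of type [nu'], in
    the same degree, the block sum of [nu] is 0 while the total power sum is not. *)
Lemma necessary_disjoint nu nu' j j' : nu <> nu' ->
  (0 < j <= #|fiber nu|)%N -> (0 < j' <= #|fiber nu'|)%N -> (h nu * j <> h nu' * j')%N.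
Proof.
move=> /eqP nn hj hj' e; have /andP[j0 _] := hj; have /andP[j'0 _] := hj'.
have [A hA] := block_psum_linear j0 (block_psum_poly nu j).
have [x [xj _ x0 xk]] := block_witness hj.
have [x' [_ x'o x'0 x'k]] := block_witness hj'.
have A0 : A != 0.
  have := natr_neq0 charK j0; rewrite -xj (hA x x0).
  by apply: contra => /eqP ->; rewrite mul0r.
have := hA x'; rewrite e x'o // x'k => /(_ x'0) /esym/eqP; apply/negP.
by rewrite !mulf_neq0 ?necessary_lambda ?natr_neq0.
Qed.

End Param.

(** * The closure of the set of factorizations *)

Lemma Xn_sub_expn_factor (K : closedFieldType) (d : nat) (zeta : K) (x : K) :
  d.-primitive_root zeta ->
  'X^d - (x ^+ d)%:P = \prod_(b < d) ('X - (zeta ^+ b * x)%:P).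
Proof.
move=> zp; have d0 := prim_order_gt0 zp.
apply: poly_eq_points => t; rewrite !hornerE horner_prod.
under eq_bigr => b _ do rewrite hornerXsubC.
have [->|x0] := eqVneq x 0.
  under eq_bigr => b _ do rewrite mulr0 subr0.
  by rewrite prodr_const card_ord expr0n eqn0Ngt d0 subr0.
have := congr1 (fun p => p.[t / x]) (factor_Xn_sub_1 zp).
rewrite big_mkord horner_prod !hornerE => e.
have -> : t ^+ d - x ^+ d = x ^+ d * ((t / x) ^+ d - 1).
  by rewrite mulrBr mulr1 -exprMn mulrCA divff // mulr1.
rewrite -e -[in x ^+ d](card_ord d) -prodr_const -big_split /=.
by apply: eq_bigr => b _; rewrite hornerXsubC mulrBr mulrCA divff // mulr1 mulrC.
Qed.

Lemma monic_coefs (K : nzRingType) (m : nat) (q : {poly K}) :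
  q \is monic -> size q = m.+1 -> q = 'X^m + rVpoly (\row_(j < m) q`_j).
Proof.
move=> /monicP; rewrite /lead_coef => lq sq; rewrite sq /= in lq.
apply/polyP => k; rewrite coefD coefXn coef_rVpoly.
case: insubP => [j _ <-|]; first by rewrite mxE ltn_eqF ?add0r ?ltn_ord.
rewrite -leqNgt leq_eqVlt => /orP[/eqP <-|lt_mk]; first by rewrite eqxx addr0 lq.
by rewrite gtn_eqF // addr0 nth_default // sq.
Qed.

Lemma Fbar_coefs (K : fieldType) (m : nat) (q : {poly K}) :
  q \is monic -> size q = m.+1 -> Fbar (\row_(j < m) q`_j) = q.
Proof.
move=> mq sq; rewrite [RHS](monic_coefs mq sq) /Fbar; congr (_ + _).
rewrite /rVpoly poly_def; apply: eq_bigr => j _.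
by rewrite insubT // => hj; congr (_ *: _); rewrite !mxE.
Qed.

Section Closure.
Variables (K : closedFieldType) (charK : [pchar K] =i pred0).
Variables (a d m r : nat) (d_gt0 : (0 < d)%N) (zeta : K) (zeta_prim : d.-primitive_root zeta).
Variables (pi : profile d) (pi_adm : admissible a m r pi).
Variables (S : necklace d -> {set 'I_d}) (S_rep : forall nu, represents (S nu) nu).
Variables (tau : 'I_m -> necklace d).
Hypothesis tau_count : forall nu, #|[set i | tau i == nu]| = block_count pi nu.
Implicit Types (x : 'rV[K]_m) (nu : necklace d).

Local Notation root_indices := (root_indices tau S).
Local Notation R := #|root_indices|.
Local Notation param_poly := (param_poly zeta tau S).
Local Notation param_coefs := (@param_coefs K d zeta m tau S).
Local Notation e := (zero_mult pi).

Lemma card_root_indices_profile : R = (r - e)%N.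
Proof.
have [_ _ _ <-] := pi_adm.
rewrite (card_root_indices tau S_rep) (partition_big tau xpredT) //=.
apply: eq_bigr => nu _; rewrite -tau_count -sum1_card big_distrl /=.
by apply: eq_big => [i|i /eqP ->]; rewrite ?inE // mul1n.
Qed.

Lemma zero_mult_le : (e <= a)%N /\ (e <= r)%N.
Proof. by have [_ + _ _] := pi_adm; rewrite leq_min => /andP. Qed.

Definition cofactor_poly x : {poly K} :=
  \prod_(p | p \notin root_indices) ('X - (param_root zeta x p)%:P).

Definition block_poly x : {poly K} := \prod_i ('X - (x 0 i ^+ d)%:P).

Definition param_t x : 'rV[K]_m := \row_j (block_poly x)`_j.

Definition gpoly x : {poly K} := 'X^e * param_poly x.

Definition hpoly x : {poly K} := 'X^(a - e) * cofactor_poly x.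

Lemma Fbar_param x : Fbar (param_t x) = block_poly x.
Proof.
apply: Fbar_coefs; first by apply: monic_prod => i _; apply: monicXsubC.
by rewrite /block_poly size_prod_XsubC -count_predT count_index_enum card_ord.
Qed.

Lemma gpoly_monic x : gpoly x \is monic /\ size (gpoly x) = r.+1.
Proof.
have [ea er] := zero_mult_le; rewrite /gpoly monicMl ?monicXn // param_poly_monic; split=> //.
rewrite size_monicM ?monicXn ?monic_neq0 ?param_poly_monic // size_polyXn size_param_poly.
by rewrite addnS /= addSn card_root_indices_profile subnKC.
Qed.

Lemma hpoly_monic x : hpoly x \is monic /\ size (hpoly x) = (a + d * m - r).+1.
Proof.
have [ea er] := zero_mult_le.
have cm : cofactor_poly x \is monic by apply: monic_prod => p _; apply: monicXsubC.
have cs : size (cofactor_poly x) = (d * m - R).+1.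
  rewrite /cofactor_poly -big_filter size_prod_XsubC size_filter count_index_enum.
  have -> : (d * m = #|{: 'I_m * 'I_d}|)%N by rewrite card_prod !card_ord mulnC.
  by rewrite -(cardC (mem root_indices)) addKn; congr (_.+1); apply: eq_card => p.
rewrite /hpoly monicMl ?monicXn // cm; split=> //.
rewrite size_monicM ?monicXn ?monic_neq0 // size_polyXn cs.
have Rle : (R <= d * m)%N.
  by apply: leq_trans (max_card _) _; rewrite card_prod !card_ord mulnC.
rewrite card_root_indices_profile in Rle *; rewrite addnS /= addSn; congr (_.+1).
by move: (d * m)%N ea er Rle => dm; lia.
Qed.

Lemma gpoly_hpoly x : gpoly x * hpoly x = Fpoly a d (param_t x).
Proof.
have [ea er] := zero_mult_le.
rewrite Fpoly_Fbar Fbar_param /gpoly /hpoly mulrACA -exprD subnKC //; congr (_ * _).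
rewrite /block_poly rmorph_prod /=.
under [RHS]eq_bigr => i _ do
  rewrite rmorphB /= comp_polyX comp_polyC (Xn_sub_expn_factor _ zeta_prim).
rewrite pair_bigA /= (bigID (mem root_indices)) /=; congr (_ * _).
Qed.

Lemma polyfun_hpoly : polyfun_coefs (fun x : 'rV[K]_m => x 0) hpoly.
Proof.
apply: polyfun_coefsM; first exact: polyfun_coefsC.
apply: polyfun_coefs_prod => p _; apply: polyfun_coefs_XsubC.
exact: polyfunZ (polyfunX _ p.1).
Qed.

Lemma polyfun_gpoly : polyfun_coefs (fun x : 'rV[K]_m => x 0) gpoly.
Proof.
apply: polyfun_coefsM; first exact: polyfun_coefsC.
exact: polyfun_param_coefs.
Qed.

Lemma param_factorization x : separated d x ->
  profile_factorization a m r zeta pi (gpoly x) (hpoly x).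
Proof.
move=> sx; have /separatedP [x0 xd] := sx.
have [mg sg] := gpoly_monic x; have [mh sh] := hpoly_monic x.
have xd0 i : x 0 i ^+ d != 0 by rewrite expf_neq0.
have roots_ys : all (root (Fbar (param_t x))) [tuple x 0 i ^+ d | i < m].
  apply/allP => _ /tnthP [i ->]; rewrite tnth_mktuple Fbar_param /root horner_prod.
  by apply/prodf_eq0; exists i; rewrite // hornerXsubC subrr.
have uniq_ys : uniq [tuple x 0 i ^+ d | i < m].
  by rewrite map_inj_uniq ?enum_uniq.
exists (param_t x); split=> //; last split.
- split.
    rewrite Fpoly_Fbar coefXnM ltnn subnn -horner_coef0 horner_comp hornerXn.
    rewrite expr0n eqn0Ngt d_gt0 /= Fbar_param horner_prod.
    by apply/prodf_neq0 => i _; rewrite hornerXsubC sub0r oppr_eq0.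
  exists [tuple x 0 i ^+ d | i < m]; split=> //.
  by apply/negP => /tnthP [i]; rewrite tnth_mktuple => /esym/eqP; rewrite (negbTE (xd0 i)).
- by rewrite gpoly_hpoly.
- rewrite /gpoly mupMl; last first.
    apply/negP => /(root_param_poly zeta tau S) [i [b [_ /esym/eqP]]].
    by rewrite mulf_eq0 expf_eq0 (negbTE (zeta_neq0 d_gt0 zeta_prim)) andbF (negbTE (x0 i)).
  by rewrite -[X in X ^+ _]subr0 mup_XsubCX eqxx.
exists [tuple x 0 i ^+ d | i < m], tau; split=> // i.
exists (x 0 i); first by rewrite tnth_mktuple.
have -> : read_block d zeta (gpoly x) (x 0 i) = [tuple b \in S (tau i) | b < d].
  apply: eq_mktuple => b; rewrite /gpoly rootM /root hornerXn !expf_eq0 mulf_eq0.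
  rewrite expf_eq0 (negbTE (zeta_neq0 d_gt0 zeta_prim)) (negbTE (x0 i)) !andbF /=.
  by have := root_param_poly_block d_gt0 zeta_prim tau S i b sx; rewrite /root mem_mod_ord.
exact: S_rep.
Qed.

(** After matching the blocks with [tau], a base point is chosen in each block from which the roots
    of [g] read exactly [S (tau i)]. The monic polynomials [g / X^e] and [param_poly x] both have
    degree [R], and the [R] distinct roots of the latter are roots of the former. *)
Lemma factorization_param g h' : profile_factorization a m r zeta pi g h' ->
  exists x, g = gpoly x.
Proof.
move=> [t [[ta0 _] _ [mg sg] _ [mupg [ys [tau' [uys rys hblock cblock]]]]]].
have y0 i : tnth ys i != 0.
  apply: contraNneq ta0 => yi0; have /allP/(_ _ (mem_tnth i ys)) := rys.
  rewrite yi0 /root => /eqP F0; rewrite Fpoly_Fbar coefXnM ltnn subnn -horner_coef0.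
  by rewrite horner_comp hornerXn expr0n eqn0Ngt d_gt0 F0.
(* Two assignments of types with the same multiplicities differ by a permutation of the blocks. *)
have [s hs] : exists s : 'S_m, forall i, tau' (s i) = tau i.
  have /tuple_permP [s es] : perm_eq [tuple tau i | i < m] [tuple tau' i | i < m].
    apply/allP => nu _ /=; apply/eqP.
    have cnt (u : 'I_m -> necklace d) :
        count_mem nu [tuple u i | i < m] = #|[set i | u i == nu]|.
      rewrite /= count_map -sum1_count big_enum_cond -sum1_card.
      by apply: eq_bigl => i; rewrite !inE.
    by rewrite !cnt tau_count cblock.
  exists s => i; have := congr1 (fun w : seq _ => nth (tau i) w i) es.
  rewrite -[X in nth _ X _ = _]/(val [tuple tau i | i < m]) -tnth_nth tnth_mktuple => ->.
  by rewrite -[X in nth _ X _]/(val [tuple tnth [tuple tau' i | i < m] (s i) | i < m])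
     -tnth_nth !tnth_mktuple.
have [xs hx] : exists xs : 'I_m -> K, forall i, xs i ^+ d = tnth ys (s i) /\
    forall n, root g (zeta ^+ n * xs i) = mem_mod (S (tau i)) n.
  apply: (@fin_all_exists _ (fun=> K) (fun i z => z ^+ d = tnth ys (s i) /\
    forall n, root g (zeta ^+ n * z) = mem_mod (S (tau i)) n)) => i.
  have [z zd] := hblock (s i); rewrite hs => hz.
  have : [tuple b \in S (tau i) | b < d] \in val (tau i) by apply: S_rep.
  rewrite (necklaceE d_gt0 hz) => /(rotationsP d_gt0) [k hk].
  exists (zeta ^+ k * z); split.
    by rewrite exprMn -exprM mulnC exprM (prim_expr_order zeta_prim) expr1n mul1r.
  move=> n; rewrite /mem_mod hk mulrA -exprD /letter.
  rewrite -[RHS]/(nth false (read_block d zeta g z) (Ordinal (ltn_pmod (n + k) d_gt0))).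
  by rewrite -tnth_nth tnth_mktuple /= (prim_expr_mod zeta_prim).
pose x : 'rV[K]_m := \row_i xs i.
have sx : separated d x.
  apply/separatedP; split=> [i|i l /=]; rewrite !mxE.
    by apply: contra (y0 (s i)) => /eqP xi0; rewrite -(hx i).1 xi0 expr0n eqn0Ngt d_gt0.
  by rewrite !(hx _).1 => /(tuple_uniqP _ uys) /perm_inj.
exists x; have [ea er] := zero_mult_le.
have g0 : g != 0 by rewrite monic_neq0.
have /dvdpP [q eg] : 'X^e %| g.
  by rewrite -[X in X ^+ _]subr0 -mup_geq // mupg.
have mq : q \is monic by move: mg; rewrite eg monicMr ?monicXn.
have sq : size q = R.+1.
  move: sg; rewrite eg size_Mmonic ?monic_neq0 ?monicXn // size_polyXn addnS /=.
  by rewrite card_root_indices_profile; lia.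
have [x0 xd] := separatedP _ _ sx.
have z0 n : zeta ^+ n != 0 by rewrite expf_neq0 // (zeta_neq0 d_gt0 zeta_prim).
suff /eqP epq : param_poly x == q by rewrite eg /gpoly epq mulrC.
rewrite -eqp_monic ?param_poly_monic // -dvdp_size_eqp ?size_param_poly ?sq //.
have -> : param_poly x =
    \prod_(z <- [seq param_root zeta x p | p <- enum root_indices]) ('X - z%:P).
  by rewrite big_map big_enum.
apply: uniq_roots_dvdp.
  apply/allP => _ /mapP [[i b] + ->]; rewrite mem_enum inE /= => hb.
  have : root g (zeta ^+ b * xs i) by rewrite (hx i).2 mem_mod_ord.
  rewrite eg rootM /root hornerXn expf_eq0 mulf_eq0 (negbTE (z0 b)) /=.
  by have := x0 i; rewrite /param_root /= mxE => /negbTE ->; rewrite andbF orbF.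
rewrite uniq_rootsE map_inj_in_uniq ?enum_uniq // => -[i b] [l c] _ _.
rewrite /param_root /= => eil.
have il : i = l.
  apply: xd => /=; have := congr1 (fun u => u ^+ d) eil.
  rewrite !exprMn -!exprM ![(_ * d)%N]mulnC !exprM.
  by rewrite (prim_expr_order zeta_prim) !expr1n !mul1r.
rewrite il in eil *; move/(mulIf (x0 l))/eqP: eil.
by rewrite (eq_prim_root_expr zeta_prim) !modn_small // => /eqP /val_inj ->.
Qed.

Lemma Fpoly_coef0 (t : 'rV[K]_m) k : k \notin exponent_set a d m -> (Fpoly a d t)`_k = 0.
Proof.
move=> hk; have hj j : (j <= m)%N -> (k == a + d * j)%N = false.
  move=> jm; apply: contraNF hk => /eqP ->; apply/mapP; exists j => //.
  by rewrite mem_iota.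
rewrite /Fpoly coefD coefXn hj // add0r coef_sum big1 // => j _.
by rewrite coefZ coefXn hj ?mulr0 // ltnW.
Qed.

Lemma monic_form_gpoly (c : 'rV[K]_(r - e)) x :
  (forall l, c 0 l = (param_poly x)`_l) -> monic_form c = poly_rV (gpoly x).
Proof.
move=> hc; have sx : size (param_poly x) = (r - e).+1.
  by rewrite size_param_poly card_root_indices_profile.
rewrite /monic_form /gpoly; congr (poly_rV ('X^ _ * _)).
rewrite [RHS](monic_coefs (param_poly_monic zeta tau S x) sx); congr (_ + rVpoly _).
by apply/rowP => l; rewrite hc mxE.
Qed.

(** Separated parameters give actual factorizations with the required profile; the others lie in the
    closure because the pullback of [P] is polynomial in [x]. *)
Lemma param_in_W x : @W K a d m r zeta pi (poly_rV (gpoly x)) (poly_rV (hpoly x)).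
Proof.
have [mg sg] := gpoly_monic x; have [mh sh] := hpoly_monic x.
have g0 : (poly_rV (gpoly x) : 'rV_r.+1) != 0.
  by rewrite -(inj_eq (can_inj rVpolyK)) poly_rV_K ?sg // linear0 monic_neq0.
have h0 : (poly_rV (hpoly x) : 'rV_(a + d * m - r).+1) != 0.
  by rewrite -(inj_eq (can_inj rVpolyK)) poly_rV_K ?sh // linear0 monic_neq0.
split; split=> //.
  by move=> k hk; rewrite !poly_rV_K ?sg ?sh // gpoly_hpoly Fpoly_coef0.
move=> D E P _ hP.
pose q (y : 'rV[K]_m) := P.@[row_mx (poly_rV (gpoly y) : 'rV_r.+1)
  (poly_rV (hpoly y) : 'rV_(a + d * m - r).+1) 0].
suff q0 : forall y, q y = 0 by apply: q0.
apply: (polyfun_dense (polyfun_discriminant K d m)) => [||y].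
- apply: (polyfun_comp (G := fun x => row_mx (poly_rV (gpoly x) : 'rV_r.+1)
      (poly_rV (hpoly x) : 'rV_(a + d * m - r).+1) 0)); last by exists P.
  move=> l; case: (split_ordP l) => j ->.
    by apply: polyfun_ext (polyfun_gpoly j) => y; rewrite row_mxEl mxE.
  by apply: polyfun_ext (polyfun_hpoly j) => y; rewrite row_mxEr mxE.
- by have [y hy] := separated_exists charK d_gt0 m; exists y; rewrite discriminant_neq0.
rewrite discriminant_neq0 => sy; apply: hP.
by exists (gpoly y), (hpoly y); split=> //; apply: param_factorization.
Qed.

Section Homogenize.
Variables (q n D : nat) (idx : 'I_n -> 'I_r.+1) (f : {mpoly K[n]}).

(** The coefficient of [X^r] in [G] is the homogenizing variable: it equals 1 on the monic chart.
    The coefficients of [H] do not occur, which gives bidegree [(D, 0)]. *)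
Definition homog_mon (mon : 'X_{1..n}) : 'X_{1..r.+1 + q.+1} :=
  (U_(lshift q.+1 ord_max) *+ (D - mdeg mon) + \sum_i U_(lshift q.+1 (idx i)) *+ mon i)%MM.

Definition homogenize : {mpoly K[r.+1 + q.+1]} :=
  \sum_(mon <- msupp f) f@_mon *: 'X_[homog_mon mon].

Lemma meval_homogenize (G : 'rV[K]_r.+1) (H : 'rV[K]_q.+1) : G 0 ord_max = 1 ->
  homogenize.@[row_mx G H 0] = f.@[fun i => G 0 (idx i)].
Proof.
move=> G1; rewrite meval_sum mevalE; apply: eq_bigr => mon _; rewrite mevalZ; congr (_ * _).
rewrite mpolyXD mevalM -mprodXE -mpolyXn mevalXn mevalXU row_mxEl G1 expr1n mul1r.
rewrite rmorph_prod; apply: eq_bigr => i _ /=.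
by rewrite -mpolyXn mevalXn mevalXU row_mxEl.
Qed.

Lemma homogenize_bihomogeneous : (msize f <= D.+1)%N -> bihomogeneous D 0 homogenize.
Proof.
move=> sf mon' hmon'.
have [mon hmon ->] : exists2 mon, mon \in msupp f & mon' = homog_mon mon.
  move: hmon'; rewrite mcoeff_msupp /homogenize raddf_sum /= => hne.
  have /hasP [mon hm] : has (fun mon => homog_mon mon == mon') (msupp f).
    apply: contraNT hne => /hasPn h0; rewrite big1_seq // => mon /andP[_ /h0 hm].
    by rewrite mcoeffZ mcoeffX (negbTE hm) mulr0.
  by move=> /eqP <-; exists mon.
have dm : (mdeg mon <= D)%N by rewrite -ltnS; apply: leq_trans (msize_mdeg_lt hmon) sf.
have Ul (i j : 'I_r.+1) : (U_(lshift q.+1 i)%MM (lshift q.+1 j) = (i == j) :> nat)%N.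
  by rewrite mnm1E (inj_eq (@lshift_inj _ _)).
have Ur (i : 'I_r.+1) (j : 'I_q.+1) : (U_(lshift q.+1 i)%MM (rshift r.+1 j) = 0)%N.
  by rewrite mnm1E eq_lrshift.
have sumU (i : 'I_r.+1) : (\sum_(j < r.+1) (i == j) = 1)%N.
  by rewrite (bigD1 i) //= eqxx big1 // => j nj; rewrite eq_sym (negbTE nj).
split.
  under eq_bigr => j _ do rewrite mnmDE mulmnE mnm_sumE Ul.
  rewrite big_split /= -big_distrl /= sumU mul1n exchange_big /=.
  have -> : (\sum_(i < n) \sum_(j < r.+1) (U_(lshift q.+1 (idx i)) *+ mon i)%MM (lshift q.+1 j)
      = mdeg mon)%N.
    rewrite mdegE; apply: eq_bigr => i _.
    under eq_bigr => j _ do rewrite mulmnE Ul.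
    by rewrite -big_distrl /= sumU mul1n.
  by rewrite subnK.
rewrite big1 // => j _; rewrite mnmDE mulmnE Ur mul0n add0n mnm_sumE big1 // => i _.
by rewrite mulmnE Ur.
Qed.

End Homogenize.

(** If [c] is not of the form [param_poly x], a polynomial [f] vanishes on the image of the
    parametrization but not at [c]. Its homogenization vanishes at every factorization and excludes
    [c] from the closure, whatever the second factor [H] is. *)
Lemma Ymon_param (c : 'rV[K]_(r - e)) :
  @Ymon K a d m r zeta pi c <-> exists x, forall l, c 0 l = (param_poly x)`_l.
Proof.
have [ea er] := zero_mult_le; split; last first.
  move=> [x hx]; exists (poly_rV (hpoly x)).
  by rewrite (monic_form_gpoly hx); apply: param_in_W.
move=> [H [_ [_ _ hcl]]].
pose p : {poly K} := 'X^(r - e) + rVpoly c.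
have lt_c : (size (rVpoly c) < size ('X^(r - e) : {poly K})%R)%N.
  by rewrite size_polyXn ltnS size_poly.
have mp : p \is monic by rewrite monicE lead_coefDl // lead_coefXn.
have sp : size p = R.+1 by rewrite size_polyDl // size_polyXn card_root_indices_profile.
have pc (l : 'I_(r - e)) : p`_l = c 0 l.
  by rewrite coefD coefXn ltn_eqF // add0r coef_rVpoly_ord.
have [[x ex]|[f fp fx]] := param_poly_closed zeta mp sp.
  by exists x => l; rewrite ex pc.
have lt_er (i : 'I_R) : (e + i < r.+1)%N.
  by have := ltn_ord i; rewrite {2}card_root_indices_profile; lia.
pose idx (i : 'I_R) : 'I_r.+1 := Ordinal (lt_er i).
have lead_G (u : {poly K}) : u \is monic -> size u = R.+1 -> ('X^e * u)`_r = 1.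
  move=> mu su; rewrite coefXnM ltnNge er /= -[X in _`_X]/(r - e).+1.-1.
  by rewrite -card_root_indices_profile -su; apply/eqP; rewrite -monicE.
have := hcl _ _ _ (@homogenize_bihomogeneous (a + d * m - r)%N _ _ idx f (leqnSn (msize f))) _.
rewrite meval_homogenize; last by rewrite mxE /= lead_G.
have GE (u : {poly K}) :
    f.@[fun i => (poly_rV ('X^e * u) : 'rV_r.+1) 0 (idx i)] = f.@[fun i => u`_i].
  by apply: meval_eq => i; rewrite mxE /= coefXnM ltnNge leq_addr /= addKn.
rewrite GE => f0; case/eqP: fp; apply: f0.
move=> _ _ [g [h' [pgh [-> ->]]]]; have [x ->] := factorization_param pgh.
rewrite meval_homogenize; last by rewrite mxE /= lead_G ?param_poly_monic ?size_param_poly.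
by rewrite GE; apply: fx.
Qed.

End Closure.

(** * From the parametrization to the normality criterion *)

Lemma exists_count (T : finType) (n : T -> nat) (m : nat) :
  (\sum_x n x = m)%N -> exists tau : 'I_m -> T, forall x, #|[set i | tau i == x]| = n x.
Proof.
move=> sn; pose s := flatten [seq nseq (n x) x | x <- enum T].
have ss : size s == m.
  by rewrite size_flatten /shape -map_comp sumnE big_map big_enum -sn;
     apply/eqP; apply: eq_bigr => x _; rewrite /= size_nseq.
exists (tnth (Tuple ss)) => x; rewrite -sum1_card.
transitivity (count_mem x s).
  rewrite -sum1_count -[s]/(tval (Tuple ss)) big_mkcond big_tuple -big_mkcond.
  by apply: eq_bigl => i; rewrite inE.
rewrite count_flatten -map_comp sumnE big_map big_enum /= (bigD1 x) //= big1 => [|y ny].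
  by rewrite count_nseq /= eqxx mul1n addn0.
by rewrite count_nseq /= (negbTE ny).
Qed.

Lemma degree_setP d (pi : profile d) nu k :
  reflect (exists2 j, (0 < j <= block_count pi nu)%N & k = (stab_order nu * j)%N)
    (k \in degree_set pi nu).
Proof.
apply: (iffP mapP) => -[j hj ->]; exists j => //; move: hj; rewrite mem_iota add1n ltnS //.
Qed.

Lemma disjoint_degreesP d (pi : profile d) : (0 < d)%N ->
  disjoint_degrees pi <-> forall nu nu' j j', nu <> nu' ->
    (0 < j <= block_count pi nu)%N -> (0 < j' <= block_count pi nu')%N ->
    (stab_order nu * j <> stab_order nu' * j')%N.
Proof.
move=> d0; split=> [dis nu nu' j j' nn hj hj' ejj|dis nu nu' _ _ nn k].
  have [n0 n'0] : (0 < block_count pi nu)%N /\ (0 < block_count pi nu')%N.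
    case/andP: hj => hj0 hj; case/andP: hj' => hj'0 hj'.
    by split; [apply: leq_trans hj|apply: leq_trans hj'].
  have hk : (stab_order nu * j)%N \in degree_set pi nu by apply/degree_setP; exists j.
  by apply: (negP (dis nu nu' n0 n'0 nn _ hk)); apply/degree_setP; exists j'.
move=> /degree_setP [j hj ->]; apply/degree_setP => -[j' hj'].
exact: dis.
Qed.

Lemma param_image_normality (K : closedFieldType) (charK : [pchar K] =i pred0)
    (d : nat) (d_gt0 : (0 < d)%N) (zeta : K) (zeta_prim : d.-primitive_root zeta)
    (m n : nat) (tau : 'I_m -> necklace d) (S : necklace d -> {set 'I_d})
    (pi : profile d) (Y : 'rV[K]_n -> Prop) :
  (forall nu, represents (S nu) nu) -> (forall i, (0 < #|S (tau i)|)%N) ->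
  (forall nu, #|fiber tau nu| = block_count pi nu) ->
  #|root_indices tau S| = n ->
  (forall y, Y y <-> exists x, forall l, y 0 l = (param_poly zeta tau S x)`_l) ->
  (normal_variety Y -> disjoint_degrees pi /\ nonzero_fourier zeta pi S) /\
  (disjoint_degrees pi /\ nonzero_fourier zeta pi S ->
     isomorphic_varieties Y (@affine_space K m)).
Proof.
(* The ambient dimension [n] is a variable so that it can be replaced by [#|root_indices tau S|]
   without casts; for the chart it is [r - e]. *)
move=> S_rep S0 tau_count eR Yimg; case: n / eR in Y Yimg *.
have Yimg' y : Y y <-> exists x, y = \row_l (@param_coefs _ _ zeta _ tau S) x l.
  rewrite Yimg; split=> -[x hx]; exists x; first by apply/rowP => l; rewrite hx mxE.
  by rewrite hx => l; rewrite mxE.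
split=> [Ynorm|[/(disjoint_degreesP _ d_gt0) dis nz]].
  have hp nu j := normal_polyfun_block_psum charK d_gt0 zeta_prim S_rep S0 nu j Yimg' Ynorm.
  split=> [|nu _ j hj].
    apply/disjoint_degreesP => // nu nu' j j' nn hj hj'.
    by apply: (necessary_disjoint charK d_gt0 zeta_prim S_rep hp nn); rewrite tau_count.
  by apply: (necessary_lambda charK d_gt0 zeta_prim S_rep hp); rewrite tau_count.
apply: (param_image_iso charK d_gt0 zeta_prim S_rep _ _ Yimg') => [nu nu' j j'|nu j].
  by rewrite !tau_count; apply: dis.
rewrite tau_count => hj; apply: nz => //.
by case/andP: hj => j0; apply: leq_trans.
Qed.

Theorem theorem6p1 (K : closedFieldType) (charK : [pchar K] =i pred0)
    (a d m r : nat) (d_ge1 : (1 <= d)%N) (m_ge1 : (1 <= m)%N)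
    (s_ge2 : (2 <= m.+1)%N) (s_le_r : (m.+1 <= r)%N)
    (r_lt_N : (r < a + d * m)%N)
    (zeta : K) (zeta_prim : d.-primitive_root zeta)
    (pi : profile d) (pi_adm : admissible a m r pi) (pi_dom : dominant pi)
    (S : necklace d -> {set 'I_d}) (S_rep : forall nu, represents (S nu) nu) :
  let Y : 'rV[K]_(r - zero_mult pi) -> Prop := @Ymon K a d m r zeta pi in
  (normal_variety Y <->
     disjoint_degrees pi /\ nonzero_fourier zeta pi S) /\
  (disjoint_degrees pi /\ nonzero_fourier zeta pi S ->
     isomorphic_varieties Y (@affine_space K m) /\ smooth_variety Y).
Proof.
move=> Y; have [_ _ sum_m _] := pi_adm.
have [tau tau_count] := exists_count sum_m.
have S0 i : (0 < #|S (tau i)|)%N.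
  rewrite -(weightE (S_rep (tau i))); apply: pi_dom; rewrite -tau_count.
  by apply/card_gt0P; exists i; rewrite inE.
have [nec suf] := param_image_normality charK d_ge1 zeta_prim (Y := Y) S_rep S0 tau_count
  (card_root_indices_profile pi_adm S_rep tau_count)
  (Ymon_param charK d_ge1 zeta_prim pi_adm S_rep tau_count).
split; first split=> //.
  by move=> /suf iso; apply: iso_affine_normal iso.
by move=> /suf iso; split=> //; apply: iso_affine_smooth iso.
Qed.
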